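(* Let $(\nu(i))_{i\ge0}$ be a positive decreasing sequence such that $\sum_{i=0}^{\infty}\sqrt{\nu(i)/(i+1)}<\infty$ and $E((f(X_{i,m})-f(X_i))^2)\le \nu(i)$ for all integers $i,m\ge 0$. Let $\theta$ be an increasing (not necessarily strictly) function on $[0,\infty)$ with $\theta(x)=1$ for $x\in[0,1]$, $\sum_{l=0}^\infty 1/\theta(l)<\infty$, and $$\sum_{i=0}^\infty\sqrt{\frac{\nu(i)\,\theta(\log_2(4i+1))}{i+1}}<\infty,$$ and let $p_l=\frac{1}{\theta(l)2^l}-\frac1{\theta(l+1)2^{l+1}}$ for $l\ge0$. For $j\ge 0$ put $$\overline{\nu}(j)=\sum_{i=j}^{\infty}\sqrt{\frac{\nu(i)}{i+1}},\qquad \overline{\nu}_\theta(j)=\sum_{i=j}^\infty\sqrt{\frac{\nu(i)\,\theta(\log_2(4i+1))}{i+1}},$$ and let $\mu=\lim_{h\to\infty}E(f(X_h))$ (which exists and is finite under these hypotheses). Let $q\in(0,1]$ and let $\hat f_k$ be the estimator built from $(p_l)_{l\ge0}$ and $q$, with expected simulation time $\hat T_k$. Then, for every $k\ge1$, $\hat f_k$ is square-integrable, $E(\hat f_k)=\mu$, $$k\operatorname{Var}(\hat f_k)\le k\operatorname{Var}(f_k)+796\,(\overline{\nu}(0))^2\sqrt{\frac{b'(k)-b(k)}{k}}+\frac{28}{q}\,\big(\overline{\nu}_\theta(\lfloor b'(k)/2\rfloor)\big)^2,$$ and $\hat T_k\le k+3\big(\sum_{l=0}^\infty 1/\theta(l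)\big)qk$.
   Context: Setting: $F,F'$ are measurable spaces, $g:F\times F'\to F$ is measurable, $(U_i)_{i\in\mathbb Z}$ are i.i.d. $F'$-valued random variables, $X_0\in F$ is deterministic, and $X_{i+1}=g(X_i,U_i)$ for $i\ge0$. The function $f:F\to\mathbb R$ is measurable and $f(X_i)$ is square-integrable for every $i\ge0$. For $m\in\mathbb Z$, $(X_{i,m})_{i\ge -m}$ is defined by $X_{-m,m}=X_0$ and $X_{i+1,m}=g(X_{i,m},U_i)$ for $i\ge -m$; in particular $X_{i,0}=X_i$ for $i\ge0$. Estimators: for $k\ge1$ fix integers $0\le b(k)\le b'(k)\le k/2$ and set $$f_k=\frac1{k-b(k)}\sum_{i=b(k)}^{k-1}f(X_i),\qquad f_{k,l}=\frac1{k-b'(k)}\sum_{i=b'(k)}^{k-1}f(X_{i,k(2^l-1)})\quad(l\ge0).$$ Given a probability distribution $(p_l)_{l\ge0}$ on the non-negative integers with all $p_l>0$, let $N$ be independent of $(U_i)_{i\in\mathbb Z}$ with $\Pr(N=l)=p_l$, and $Z_k=(f_{k,N+1}-f_{k,N})/p_N$. Given $q\in(0,1]$, let $Z'_k$ be a copy of $Z_k$ independent of $f_{k,0}$, let $Q\in\{0,1\}$ be independent of $(f_{k,0},Z'_k)$ with $\Pr(Q=1)=q$, and set $\hat f_k=f_{k,0}+q^{-1}QZ'_k$. Cost model: simulating $f_k$ takes expected time $k$, and simulating $f_{k,l}$ takes expected time $k2^l$, so the expected time $\tau_{k,l}$ to simulate $f_{k,l+1}-f_{k,l}$ satisfies $\tau_{k,l}\le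 k2^{l+1}+k2^l=3k2^l$. The expected time to simulate $Z_k$ is $T_k=\sum_{l\ge0}p_l\tau_{k,l}$, and the expected time to simulate $\hat f_k$ is $\hat T_k=k+qT_k$. *)

(* Defs.v *)
From HB Require Import structures.
From mathcomp Require Import all_boot all_order all_algebra.
From mathcomp Require Import all_classical all_reals all_analysis.

Set Implicit Arguments.
Unset Strict Implicit.
Unset Printing Implicit Defensive.

Import Order.TTheory GRing.Theory Num.Theory.
Import numFieldNormedType.Exports.

Local Open Scope classical_set_scope.
Local Open Scope ring_scope.

Section Probability.
Context {d : measure_display} {Omega : measurableType d} {R : realType}.
Variable P : probability Omega R.

Definition same_law {d' : measure_display} {T : measurableType d'}
    (X Y : Omega -> T) : Prop :=
  forall A : set T, measurable A -> P (X @^-1` A) = P (Y @^-1` A).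

Definition independent {d1 d2 : measure_display}
    {T1 : measurableType d1} {T2 : measurableType d2}
    (X : Omega -> T1) (Y : Omega -> T2) : Prop :=
  forall (A : set T1) (B : set T2), measurable A -> measurable B ->
    P (X @^-1` A `&` Y @^-1` B) = (P (X @^-1` A) * P (Y @^-1` B))%E.

Definition mutually_independent {d' : measure_display}
    {T : measurableType d'} {I : choiceType} (U : I -> Omega -> T) : Prop :=
  forall (J : seq I) (A : I -> set T), uniq J ->
    (forall i, i \in J -> measurable (A i)) ->
    P (\bigcap_(i in [set` J]) (U i @^-1` A i)) =
    (\prod_(i <- J) P (U i @^-1` A i))%E.

Definition iid {d' : measure_display} {T : measurableType d'}
    {I : choiceType} (U : I -> Omega -> T) : Prop :=
  mutually_independent U /\ forall i j, same_law (U i) (U j).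

Definition sigma_family {d' : measure_display} {T : measurableType d'}
    {I : Type} (U : I -> Omega -> T) : set (set Omega) :=
  <<s \bigcup_i preimage_set_system setT (U i) measurable >>.

Definition independent_of_family {d1 d2 : measure_display}
    {T1 : measurableType d1} {T2 : measurableType d2} {I : Type}
    (X : Omega -> T1) (U : I -> Omega -> T2) : Prop :=
  forall (A : set T1) (E : set Omega), measurable A -> sigma_family U E ->
    P (X @^-1` A `&` E) = (P (X @^-1` A) * P E)%E.

End Probability.

Section Chain.
Context {Omega F F' : Type}.
Variables (g : F * F' -> F) (U : int -> Omega -> F') (x0 : F).

Fixpoint chain (i : nat) (w : Omega) : F :=
  if i is j.+1 then g (chain j w, U j%:Z w) else x0.

(* The chain started from x0 at time s, after n steps, i.e. at time s + n. *)
Fixpoint chain_from (s : int) (n : nat) (w : Omega) : F :=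
  if n is j.+1 then g (chain_from s j w, U (s + j%:Z)%R w) else x0.

(* X_{i,m}; only meaningful for - m <= i. *)
Definition shifted_chain (i m : int) : Omega -> F :=
  chain_from (- m) (absz (i + m)).

Lemma shifted_chain_start (m : int) (w : Omega) : shifted_chain (- m) m w = x0.
Proof. by rewrite /shifted_chain addNr. Qed.

Lemma shifted_chain_step (i m : int) (w : Omega) : - m <= i ->
  shifted_chain (i + 1) m w = g (shifted_chain i m w, U i w).
Proof.
rewrite -subr_ge0 opprK /shifted_chain => im.
have -> : absz (i + 1 + m) = (absz (i + m)).+1.
  by case: (i + m) im (addrAC i 1 m) => // n _ ->; rewrite -PoszD addn1.
by rewrite /= gez0_abs// addrCA addNr addr0.
Qed.

Lemma shifted_chain0 (i : nat) (w : Omega) : shifted_chain i%:Z 0 w = chain i w.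
Proof.
rewrite /shifted_chain addr0 oppr0 /=.
by elim: i => //= i ->; rewrite add0r.
Qed.

End Chain.

Section Sequences.
Context {R : realType}.
Local Open Scope ereal_scope.
Implicit Types (nu : nat -> R) (theta : R -> R).

Definition log2 (x : R) : R := (ln x / ln 2)%R.

Definition level_prob theta (l : nat) : R :=
  (1 / (theta l%:R * 2 ^+ l) - 1 / (theta l.+1%:R * 2 ^+ l.+1))%R.

Definition nu_bar nu (j : nat) : \bar R :=
  \sum_(j <= i <oo) (Num.sqrt (nu i / i.+1%:R))%:E.

Definition nu_bar_theta nu theta (j : nat) : \bar R :=
  \sum_(j <= i <oo)
    (Num.sqrt (nu i * theta (log2 (4 * i + 1)%:R) / i.+1%:R))%:E.

Definition sum_inv_theta theta : \bar R :=
  \sum_(0 <= l <oo) (1 / theta l%:R)%:E.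

End Sequences.

Section Estimators.
Context {Omega F F' : Type} {R : realType}.
Variables (g : F * F' -> F) (U : int -> Omega -> F') (x0 : F) (f : F -> R).

Definition time_average (b : nat -> nat) (k : nat) (w : Omega) : R :=
  (k - b k)%:R^-1 * \sum_(b k <= i < k) f (chain g U x0 i w).

Definition level_average (b' : nat -> nat) (k l : nat) (w : Omega) : R :=
  (k - b' k)%:R^-1 *
  \sum_(b' k <= i < k) f (shifted_chain g U x0 i%:Z (k * (2 ^ l - 1))%N%:Z w).

Definition Z_estimator (b' : nat -> nat) (p : nat -> R) (N : Omega -> nat)
    (k : nat) (w : Omega) : R :=
  (level_average b' k (N w).+1 w - level_average b' k (N w) w) / p (N w).

(* Z' is an independent copy of Z_k, on the same probability space. *)
Definition unbiased_estimator (b' : nat -> nat) (q : R) (Z' : Omega -> R)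
    (Q : Omega -> bool) (k : nat) (w : Omega) : R :=
  level_average b' k 0 w + q^-1 * (Q w)%:R * Z' w.

End Estimators.

Section Cost.
Context {R : realType}.
Local Open Scope ereal_scope.

(* Expected time to simulate f_{k,l}. Below, tau k l stands for the expected
   time to simulate f_{k,l+1} - f_{k,l}; it is kept abstract, its bound by the
   sum of the two level times being a hypothesis. *)
Definition level_time (k l : nat) : R := (k * 2 ^ l)%:R.

Definition Z_time (p : nat -> R) (tau : nat -> nat -> R) (k : nat) : \bar R :=
  \sum_(0 <= l <oo) (p l * tau k l)%:E.

Definition unbiased_time (p : nat -> R) (tau : nat -> nat -> R) (q : R)
    (k : nat) : \bar R :=
  k%:R%:E + q%:E * Z_time p tau k.

End Cost.

(* Main.v *)
(** All chains are coupled through the common inputs: shifting time by [s] turns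
    the hypothesis into [E (f X_{i,m} - f X_{i,m'})^2 <= nu (elapsed time)] for
    chains started at arbitrary times.

    Variance of block sums: cut a block of length [n] in two halves and restart
    the chain at the cut. The restarted half is independent of the first half, so
    the variances add up, and the restart costs at most
    [\sum_(j < n/2) sqrt (nu j)] in standard deviation. Iterating over dyadic
    scales gives a standard deviation of at most [11/2 * nu_bar 0 * sqrt n], as
    [\sum_j sqrt (nu j / (j + 1))] dominates the accumulated costs. Dropping
    the [b' - b] first terms of the average then changes [k Var] by at most
    [23 * (11/2)^2 * nu_bar(0)^2 * sqrt ((b' - b) / k)].

    Correction term: [E Z^2 = \sum_l E D_l^2 / p_l] with [D_l] the increment
    between consecutive levels. By the coupling bound, the [l]-th term is at most a
    constant times [S * T_l], where [S] is the tail [nu_bar_theta (b'/2)]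
    and the [T_l], for [l >= 1], are the parts of that series carried by disjoint
    ranges of indices of order [k 2^l]. Expectations telescope to [mu]. *)
Require Import Defs.
From HB Require Import structures.
From mathcomp Require Import all_boot all_order all_algebra.
From mathcomp Require Import all_classical all_reals all_analysis.
From mathcomp Require Import measurable_realfun.
From mathcomp Require Import ring lra zify.

Set Implicit Arguments.
Unset Strict Implicit.
Unset Printing Implicit Defensive.

Import Order.TTheory GRing.Theory Num.Theory.
Import numFieldNormedType.Exports.

Local Open Scope classical_set_scope.
Local Open Scope ring_scope.

(** * Transfer of moments between equal laws, and independent pairs *)

Section Law.
Context {d : measure_display} {Omega : measurableType d} {R : realType}.
Variable P : probability Omega R.

Lemma same_law_comp {d1 d2 : measure_display} {T1 : measurableType d1}
    {T2 : measurableType d2} (X Y : Omega -> T1) (h : T1 -> T2) :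
  measurable_fun setT h -> same_law P X Y -> same_law P (h \o X) (h \o Y).
Proof.
move=> mh XY A mA; apply: (XY (h @^-1` A)).
by rewrite -[_ @^-1` _]setTI; exact: mh.
Qed.

(** For nonnegative [h] both sides are the integral of [h] against the common distribution. The
    general case splits [h] into positive and negative parts, so no integrability is required. *)
Lemma same_law_integral {d1 : measure_display} {T : measurableType d1}
    (X Y : Omega -> T) (h : T -> \bar R) :
  measurable_fun setT X -> measurable_fun setT Y -> measurable_fun setT h ->
  same_law P X Y -> (\int[P]_w h (X w) = \int[P]_w h (Y w))%E.
Proof.
move=> mX mY mh XY.
pose FX : {RV P >-> T} := HB.pack X (isMeasurableFun.Build _ _ _ _ X mX).
pose FY : {RV P >-> T} := HB.pack Y (isMeasurableFun.Build _ _ _ _ Y mY).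
have ge0 (k : T -> \bar R) : measurable_fun setT k -> (forall x, 0 <= k x)%E ->
    (\int[P]_w k (X w) = \int[P]_w k (Y w))%E.
  move=> mk k0.
  rewrite -(ge0_integral_distribution FX mk k0).
  rewrite -(ge0_integral_distribution FY mk k0).
  by apply: eq_measure_integral => A mA _; exact: (XY A mA).
rewrite integralE [RHS]integralE; congr (_ - _)%E.
  have := ge0 (h^\+)%E (measurable_funepos mh) (fun x => funepos_ge0 h x).
  by rewrite funepos.unlock.
have := ge0 (h^\-)%E (measurable_funeneg mh) (fun x => funeneg_ge0 h x).
by rewrite funeneg.unlock.
Qed.

Lemma same_law_expectation {d1 : measure_display} {T : measurableType d1}
    (X Y : Omega -> T) (h : T -> R) :
  measurable_fun setT X -> measurable_fun setT Y -> measurable_fun setT h ->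
  same_law P X Y -> ('E_P[h \o X] = 'E_P[h \o Y])%E.
Proof.
move=> mX mY mh XY; rewrite unlock.
apply: (same_law_integral (h := EFin \o h)) => //.
exact/measurable_EFinP.
Qed.

Lemma Lfun_measurable (p : \bar R) (X : Omega -> R) :
  X \in Lfun P p -> measurable_fun setT X.
Proof. by rewrite inE => /andP[/[!inE]]. Qed.

Lemma Lfun2P (X : Omega -> R) : measurable_fun setT X ->
  ('E_P[fun w => (X w ^+ 2)%R] < +oo)%E -> X \in Lfun P 2%:E.
Proof.
move=> mX EX; rewrite inE; apply/andP; split; rewrite inE//=.
rewrite /finite_norm unlock /Lnorm poweR_lty//.
move: EX; rewrite unlock; congr (_ < _)%E.
by apply: eq_integral => w _ /=; rewrite -[2]/(2%:R) powR_mulrn// real_normK// num_real.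
Qed.

Lemma Lfun2_expectation (X : Omega -> R) : X \in Lfun P 2%:E ->
  'E_P[fun w => (X w ^+ 2)%R]%E \is a fin_num.
Proof.
move=> /Lfun2_integrable_sqr iX; apply: expectation_fin_num.
exact/Lfun1_integrable.
Qed.

Lemma same_law_Lfun2 (X Y : Omega -> R) : measurable_fun setT Y ->
  same_law P X Y -> X \in Lfun P 2%:E -> Y \in Lfun P 2%:E.
Proof.
move=> mY XY X2; apply: Lfun2P => //.
have mX := Lfun_measurable X2.
rewrite -(same_law_expectation (h := fun x : R => x ^+ 2) mX mY _ XY).
  by rewrite ltey_eq (Lfun2_expectation X2).
exact: measurable_funX.
Qed.

Lemma Lfun2_Lfun1 (X : Omega -> R) : X \in Lfun P 2%:E -> X \in Lfun P 1.
Proof. by apply: Lfun_subset12; rewrite fin_num_measure. Qed.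

(** Independence makes each joint law agree with a product of marginals on rectangles, and a measure
    with this property is unique; equal marginals therefore give equal joint laws. *)
Lemma same_law_pair {d1 d2 : measure_display} {T1 : measurableType d1}
    {T2 : measurableType d2} (X X' : Omega -> T1) (Y Y' : Omega -> T2) :
  measurable_fun setT X -> measurable_fun setT X' ->
  measurable_fun setT Y -> measurable_fun setT Y' ->
  independent P X Y -> independent P X' Y' ->
  same_law P X X' -> same_law P Y Y' ->
  same_law P (fun w => (X w, Y w)) (fun w => (X' w, Y' w)).
Proof.
move=> mX mX' mY mY' iXY iXY' XX' YY' C mC.
have mXY : measurable_fun setT (fun w => (X w, Y w)).
  exact: measurable_fun_pair.
have mXY' : measurable_fun setT (fun w => (X' w, Y' w)).
  exact: measurable_fun_pair.
pose FX : {mfun Omega >-> T1} := HB.pack X (isMeasurableFun.Build _ _ _ _ X mX).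
pose FY : {mfun Omega >-> T2} := HB.pack Y (isMeasurableFun.Build _ _ _ _ Y mY).
pose FXY : {mfun Omega >-> (T1 * T2)%type} :=
  HB.pack (fun w => (X w, Y w)) (isMeasurableFun.Build _ _ _ _ _ mXY).
pose FXY' : {mfun Omega >-> (T1 * T2)%type} :=
  HB.pack (fun w => (X' w, Y' w)) (isMeasurableFun.Build _ _ _ _ _ mXY').
have XYE : (distribution P FX \x distribution P FY)%E C = distribution P FXY C.
  apply: (product_measure_unique (m' := distribution P FXY) _ mC) => A B mA mB.
  exact: (iXY _ _ mA mB).
have XYE' : (distribution P FX \x distribution P FY)%E C = distribution P FXY' C.
  apply: (product_measure_unique (m' := distribution P FXY') _ mC) => A B mA mB.
  have := iXY' _ _ mA mB; rewrite -(XX' _ mA) -(YY' _ mB); exact.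
exact: (etrans (esym XYE) XYE').
Qed.

Lemma independent_comp {d1 d2 d3 d4 : measure_display}
    {T1 : measurableType d1} {T2 : measurableType d2}
    {T3 : measurableType d3} {T4 : measurableType d4}
    (X : Omega -> T1) (Y : Omega -> T2) (h : T1 -> T3) (k : T2 -> T4) :
  measurable_fun setT h -> measurable_fun setT k ->
  independent P X Y -> independent P (h \o X) (k \o Y).
Proof.
move=> mh mk XY A B mA mB; apply: (XY (h @^-1` A) (k @^-1` B)).
- by rewrite -[_ @^-1` _]setTI; exact: mh.
- by rewrite -[_ @^-1` _]setTI; exact: mk.
Qed.

(** The joint law is the product of the marginals. Tonelli applied to [|x| * |y|] makes the product
    integrable from mere integrability of the factors, and Fubini then factors the integral. *)
Lemma independent_expectationM (X Y : Omega -> R) :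
  X \in Lfun P 1 -> Y \in Lfun P 1 -> independent P X Y ->
  (X \* Y \in Lfun P 1) /\ ('E_P[X \* Y] = 'E_P[X] * 'E_P[Y])%E.
Proof.
move=> X1 Y1 iXY.
have [mX mY] := (Lfun_measurable X1, Lfun_measurable Y1).
have mXY : measurable_fun setT (fun w => (X w, Y w)).
  exact: measurable_fun_pair.
pose FX : {RV P >-> R} := HB.pack X (isMeasurableFun.Build _ _ _ _ X mX).
pose FY : {RV P >-> R} := HB.pack Y (isMeasurableFun.Build _ _ _ _ Y mY).
pose FXY : {RV P >-> (R * R)%type} :=
  HB.pack (fun w => (X w, Y w)) (isMeasurableFun.Build _ _ _ _ _ mXY).
pose PX : probability R R := distribution P FX.
pose PY : probability R R := distribution P FY.
have prodE (C : set (R * R)) : measurable C ->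
    (PX \x PY)%E C = distribution P FXY C.
  move=> mC; apply: (product_measure_unique (m' := distribution P FXY) _ mC).
  by move=> A B mA mB; exact: (iXY _ _ mA mB).
pose m2 := fun z : R * R => (z.1 * z.2)%:E : \bar R.
have mm2 : measurable_fun setT m2.
  by apply/measurable_EFinP; apply: measurable_funM.
have mE : measurable_fun setT (@EFin R) by exact/measurable_EFinP.
have mN : measurable_fun setT (fun x : R => `|x|%:E).
  by apply/measurable_EFinP; exact: normr_measurable.
have iX : P.-integrable setT (EFin \o X) by exact/Lfun1_integrable.
have iY : P.-integrable setT (EFin \o Y) by exact/Lfun1_integrable.
have iD (V : {RV P >-> R}) : P.-integrable setT (EFin \o V) ->
    (distribution P V).-integrable setT EFin.
  move=> /integrableP[_ iV]; apply/integrableP; split => //.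
  by rewrite ge0_integral_distribution//; exact: measurableT_comp.
have iPX : PX.-integrable setT EFin := iD FX iX.
have iPY : PY.-integrable setT EFin := iD FY iY.
have im2 : (PX \x PY)%E.-integrable setT m2.
  apply/(integrable12ltyP _ _ mm2) => /=.
  under eq_integral => x _.
    under eq_integral => y _ do rewrite normrM EFinM.
    rewrite ge0_integralZl//.
    over.
  rewrite ge0_integralZr//; last exact: integral_ge0.
  case/integrableP: iPX => _ iPX; case/integrableP: iPY => _ iPY.
  by apply: lte_mul_pinfty => //; rewrite ?ge0_fin_numE ?integral_ge0.
have iP : P.-integrable setT (EFin \o (X \* Y)).
  apply/integrableP; split; first exact/measurable_EFinP/measurable_funM.
  have /integrableP[_] := im2.
  rewrite (eq_measure_integral (distribution P FXY)); last first.
    by move=> C mC _; exact: prodE.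
  by rewrite ge0_integral_distribution//; exact: measurableT_comp.
split; first exact/Lfun1_integrable.
rewrite unlock.
transitivity (\int[distribution P FXY]_z m2 z)%E.
  by rewrite integral_distribution.
rewrite (eq_measure_integral (PX \x PY)%E); last first.
  by move=> C mC _; apply/esym; exact: prodE.
rewrite -integral12_prod_meas1// /fubini_F /m2 /=.
under eq_integral => x _.
  under eq_integral => y _ do rewrite EFinM.
  rewrite integralZl//.
  over.
have fY : (\int[PY]_y y%:E)%E \is a fin_num by exact: integrable_fin_num.
rewrite -(fineK fY) integralZr// fineK//.
by rewrite /PX /PY !integral_distribution.
Qed.

End Law.

(** * Sigma-algebras generated by disjoint sets of inputs *)

Section SigmaOn.
Context {Omega : Type} {d' : measure_display} {T : measurableType d'} {I : Type}.
Variable U : I -> Omega -> T.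

(** For [J = setT] this is the family generating [sigma_family U], so independence from all inputs
    applies to whatever is measurable with respect to it. *)
Definition preimages_on (J : set I) : set (set Omega) :=
  \bigcup_(i in J) preimage_set_system setT (U i) measurable.

End SigmaOn.

Section SigmaIndependence.
Context {d : measure_display} {Omega : measurableType d} {R : realType}.
Variable P : probability Omega R.
Context {d' : measure_display} {T : measurableType d'} {I : choiceType}.
Variable U : I -> Omega -> T.
Hypothesis mU : forall i, measurable_fun setT (U i).
Hypothesis indepU : mutually_independent P U.

(* A pi-system generating the same sigma-algebra as [preimages_on U J]. *)
Definition cylinders (J : set I) : set (set Omega) :=
  [set E | exists (s : seq I) (A : I -> set T),
     [/\ uniq s, [set` s] `<=` J, forall i, measurable (A i) &
         E = \bigcap_(i in [set` s]) (U i @^-1` A i)]].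

Lemma cylinders_setI J : setI_closed (cylinders J).
Proof.
move=> E1 E2 [s1 [A1 [u1 s1J mA1 ->]]] [s2 [A2 [u2 s2J mA2 ->]]].
(* Both index lists are merged; an index missing from one of them is padded with the trivial
   constraint [setT]. *)
pose A i := (if i \in s1 then A1 i else setT) `&`
            (if i \in s2 then A2 i else setT).
exists (undup (s1 ++ s2)), A; split.
- exact: undup_uniq.
- by move=> i /=; rewrite mem_undup mem_cat => /orP[/s1J|/s2J].
- by move=> i; apply: measurableI; case: ifP => // _; exact: measurableT.
- apply/seteqP; split => w.
    move=> [w1 w2] i /=; rewrite mem_undup mem_cat => _; split.
      by case: ifP => // s1i; exact: w1.
    by case: ifP => // s2i; exact: w2.
  move=> w12; split => i /= si.
    have := w12 i; rewrite /= mem_undup mem_cat si /= => /(_ isT)[].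
    by rewrite si.
  have := w12 i; rewrite /= mem_undup mem_cat si orbT /= => /(_ isT)[_].
  by rewrite si.
Qed.

Lemma cylinders_measurable J E : cylinders J E -> measurable E.
Proof.
move=> [s [A [_ _ mA ->]]]; rewrite bigcap_seq.
apply: bigsetI_measurable => i _.
by rewrite -[_ @^-1` _]setTI; exact: mU.
Qed.

Lemma sub_cylinders J : preimages_on U J `<=` cylinders J.
Proof.
move=> _ [i Ji [A mA <-]]; exists [:: i], (fun=> A); split => //.
- by move=> j /=; rewrite inE => /eqP ->.
- by rewrite bigcap_seq big_seq1 setTI.
Qed.

(** As the index lists are disjoint, the intersection is again a cylinder over their concatenation,
    and mutual independence splits its probability into the two products. *)
Lemma cylinders_indep (J K : set I) A B : J `&` K = set0 ->
  cylinders J A -> cylinders K B -> P (A `&` B) = (P A * P B)%E.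
Proof.
move=> JK [s [A1 [us sJ mA ->]]] [t [B1 [ut tK mB ->]]].
have st i : i \in s -> i \notin t.
  move=> si; apply/negP => it; have : (J `&` K) i by split; [exact: sJ|exact: tK].
  by rewrite JK.
pose C i := if i \in s then A1 i else B1 i.
have mC i : measurable (C i) by rewrite /C; case: ifP.
rewrite [X in P X](_ : _ = \bigcap_(i in [set` s ++ t]) (U i @^-1` C i)); last first.
  apply/seteqP; split => w.
    move=> [w1 w2] i /=; rewrite mem_cat /C; case: ifP => [si _|_ /=]; first exact: w1.
    exact: w2.
  move=> w12; split => i /= ii.
    by have := w12 i; rewrite /= mem_cat /C ii; exact.
  have := w12 i; rewrite /= mem_cat /C ii orbT.
  by rewrite (negPf (contraL (@st i) ii)); exact.
rewrite (indepU (J := s ++ t))//; last first.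
  rewrite cat_uniq us ut andbT/=; apply/hasPn => i it.
  by apply: contraL it => /st.
rewrite big_cat/= (indepU us) ?(indepU ut)//.
congr (_ * _)%E; rewrite big_seq [RHS]big_seq; apply: eq_bigr => i ii.
  by rewrite /C ii.
by rewrite /C (negPf (contraL (@st i) ii)).
Qed.

(** Pi-lambda argument: the measurable sets independent of a fixed [B] form a Dynkin system.
    Measurability is carried along because the closure properties are proved with it. *)
Lemma dynkin_indep (G : set (set Omega)) (B : set Omega) :
  setI_closed G -> G `<=` measurable -> measurable B ->
  (forall A, G A -> P (A `&` B) = (P A * P B)%E) ->
  forall A, <<s G >> A -> measurable A /\ P (A `&` B) = (P A * P B)%E.
Proof.
move=> GI Gm mB GB.
apply: (@lambda_system_subset _ G GI setT
  [set A | measurable A /\ P (A `&` B) = (P A * P B)%E]) => //.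
- apply/dynkin_lambda_system; split => /=.
  + by split; [exact: measurableT|rewrite setTI probability_setT mul1e].
  + move=> A [mA AB]; split; first exact: measurableC.
    rewrite setIC -setDE measureD//; last by rewrite ltey_eq fin_num_measure.
    transitivity (P B - P A * P B)%E.
      by congr (_ - _)%E; rewrite setIC; exact: AB.
    rewrite probability_setC// -(fineK (fin_num_measure P _ mA)).
    rewrite -(fineK (fin_num_measure P _ mB)) -!EFinM -!EFinB.
    by rewrite mulrBl mul1r.
  + move=> F tF FH; split; first by apply: bigcup_measurable => k _; case: (FH k).
    rewrite setI_bigcupl !measure_bigcup//.
    * rewrite -(fineK (fin_num_measure P _ mB)) muleC -nneseriesZl//.
      apply: eq_eseriesr => i _; case: (FH i) => _ FiB.
      by rewrite fineK ?fin_num_measure// muleC; exact: FiB.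
    * by move=> i _; case: (FH i).
    * by move=> i _; apply: measurableI => //; case: (FH i).
    * exact: trivIset_setIr.
- by move=> A GA; split; [exact: Gm|exact: GB].
Qed.

Lemma sigma_on_measurable J E : <<s preimages_on U J >> E -> measurable E.
Proof.
apply: smallest_sub; first exact: sigma_algebra_measurable.
by move=> A /sub_cylinders; exact: cylinders_measurable.
Qed.

(** The Dynkin argument is run twice: first [A] ranges over its sigma-algebra against a fixed
    cylinder, then that [A] is fixed and [B] ranges over the other sigma-algebra. *)
Lemma sigma_on_indep (J K : set I) A B : J `&` K = set0 ->
  <<s preimages_on U J >> A -> <<s preimages_on U K >> B ->
  P (A `&` B) = (P A * P B)%E.
Proof.
move=> JK JA KB.
have cyl L E : <<s preimages_on U L >> E -> <<s cylinders L >> E.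
  by apply: sub_smallest2r => //; exact: sub_cylinders.
have step1 B0 : cylinders K B0 -> P (A `&` B0) = (P A * P B0)%E.
  move=> KB0; have [] // := dynkin_indep (@cylinders_setI J)
    (@cylinders_measurable J) (cylinders_measurable KB0) _ (cyl _ _ JA).
  by move=> A0 JA0; exact: (cylinders_indep JK).
have [] // := dynkin_indep (@cylinders_setI K) (@cylinders_measurable K)
    (sigma_on_measurable JA) _ (cyl _ _ KB).
  by move=> B0 KB0; rewrite setIC step1// muleC.
by move=> _; rewrite setIC => ->; rewrite muleC.
Qed.

End SigmaIndependence.

(** * Real-valued means, variances and standard deviations *)

Section StandardDeviation.
Context {d : measure_display} {Omega : measurableType d} {R : realType}.
Variable P : probability Omega R.
Implicit Types X Y : Omega -> R.

(** [fine] sends infinite values to 0, so [mean], [var] and [sd] are informative only together with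
    integrability, which [meanE] and [varE] require. *)
Definition mean X : R := fine 'E_P[X]%E.
Definition var X : R := fine 'V_P[X]%E.
Definition sd X : R := Num.sqrt (var X).

Lemma meanE X : X \in Lfun P 1 -> ('E_P[X] = (mean X)%:E)%E.
Proof. by move=> X1; rewrite fineK// expectation_fin_num. Qed.

Lemma varE X : X \in Lfun P 2%:E -> ('V_P[X] = (var X)%:E)%E.
Proof. by move=> X2; rewrite fineK// variance_fin_num. Qed.

Lemma var_ge0 X : 0 <= var X.
Proof. by rewrite fine_ge0// variance_ge0. Qed.

Lemma sd_ge0 X : 0 <= sd X. Proof. exact: sqrtr_ge0. Qed.

Lemma sd_sqr X : sd X ^+ 2 = var X.
Proof. by rewrite sqr_sqrtr// var_ge0. Qed.

Lemma var_le_sqr X : X \in Lfun P 2%:E ->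
  var X <= mean (fun w => X w ^+ 2).
Proof.
move=> X2; rewrite /var varianceE// (meanE (Lfun2_Lfun1 X2)).
rewrite -[X in (X - _)%E]fineK; last exact: Lfun2_expectation.
by rewrite -EFin_expe -EFinB /= gerBl sqr_ge0.
Qed.

Lemma var_indepD X Y : X \in Lfun P 2%:E -> Y \in Lfun P 2%:E ->
  independent P X Y -> var (fun w => X w + Y w) = var X + var Y.
Proof.
move=> X2 Y2 iXY; rewrite /var (varianceD X2 Y2).
have [X1 Y1] := (Lfun2_Lfun1 X2, Lfun2_Lfun1 Y2).
have [XY1 XYE] := independent_expectationM X1 Y1 iXY.
rewrite covarianceE// XYE subee ?mule0 ?adde0; last first.
  by rewrite fin_numM// expectation_fin_num.
by rewrite fineD// variance_fin_num.
Qed.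

(** Minkowski's inequality for centred variables: expand the variance of the sum and bound the
    covariance by Cauchy-Schwarz. *)
Lemma sdD X Y : X \in Lfun P 2%:E -> Y \in Lfun P 2%:E ->
  sd (fun w => X w + Y w) <= sd X + sd Y.
Proof.
move=> X2 Y2; rewrite -[leRHS]ger0_norm ?addr_ge0 ?sd_ge0//.
rewrite -sqrtr_sqr ler_wsqrtr// sqrrD !sd_sqr.
have [X1 Y1] := (Lfun2_Lfun1 X2, Lfun2_Lfun1 Y2).
have cf : covariance P X Y \is a fin_num.
  by rewrite covariance_fin_num ?Lfun2_mul_Lfun1.
have cle : fine (covariance P X Y) <= sd X * sd Y.
  have := covariance_le X2 Y2.
  by rewrite (varE X2) (varE Y2) -(fineK cf) /= lee_fin.
rewrite /var (varianceD X2 Y2) (varE X2) (varE Y2) -(fineK cf) -EFinM -!EFinD /=.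
by rewrite addrAC lerD2r lerD2l mulr2n mulrDl mul1r lerD.
Qed.

Lemma sdZ a X : X \in Lfun P 2%:E -> sd (fun w => a * X w) = `|a| * sd X.
Proof.
move=> X2; rewrite /sd /var.
have -> : (fun w => a * X w) = a \o* X by apply/funext => w /=; rewrite mulrC.
by rewrite varianceZ// (varE X2) -EFinM /= sqrtrM ?sqr_ge0// sqrtr_sqr.
Qed.

Lemma Lfun2D X Y : X \in Lfun P 2%:E -> Y \in Lfun P 2%:E ->
  (fun w => X w + Y w) \in Lfun P 2%:E.
Proof.
move=> X2 Y2; have [_ LD] := Lfun_addr_closed P (lee1n 2).
exact: (LD X Y X2 Y2).
Qed.

Lemma Lfun2Z a X : X \in Lfun P 2%:E -> (fun w => a * X w) \in Lfun P 2%:E.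
Proof.
move=> X2; have -> : (fun w => a * X w) = a \o* X.
  by apply/funext => w /=; rewrite mulrC.
by apply: Lfun_scale => //; rewrite ler1n.
Qed.

Lemma Lfun2B X Y : X \in Lfun P 2%:E -> Y \in Lfun P 2%:E ->
  (fun w => X w - Y w) \in Lfun P 2%:E.
Proof.
move=> X2 Y2; have := Lfun2D X2 (Lfun2Z (- 1) Y2).
rewrite (_ : (fun _ => _) = fun w => X w - Y w)//.
by apply/funext => w; rewrite mulN1r.
Qed.

Lemma Lfun2_sum (m n : nat) (X : nat -> Omega -> R) :
  (forall i, X i \in Lfun P 2%:E) ->
  (fun w => \sum_(m <= i < n) X i w) \in Lfun P 2%:E.
Proof.
move=> X2; rewrite /index_iota; elim: (iota _ _) => [|i s IH].
  by rewrite (_ : (fun _ => _) = cst 0) ?Lfun_cst//; apply/funext => w; rewrite big_nil.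
under eq_fun do rewrite big_cons.
exact: Lfun2D.
Qed.

Lemma sd_sum n (X : nat -> Omega -> R) :
  (forall i, X i \in Lfun P 2%:E) ->
  sd (fun w => \sum_(0 <= i < n) X i w) <= \sum_(0 <= i < n) sd (X i).
Proof.
move=> X2; elim: n => [|n IH].
  rewrite (_ : (fun _ => _) = cst 0); last by apply/funext => w; rewrite big_geq.
  by rewrite big_geq// /sd /var variance_cst sqrtr0.
rewrite big_nat_recr//=; under eq_fun do rewrite big_nat_recr//=.
by apply: le_trans (sdD (Lfun2_sum 0 n X2) (X2 n)) _; rewrite lerD2r.
Qed.

Lemma meanD X Y : X \in Lfun P 1 -> Y \in Lfun P 1 ->
  mean (fun w => X w + Y w) = mean X + mean Y.
Proof.
by move=> X1 Y1; rewrite /mean (expectationD X1 Y1) fineD ?expectation_fin_num.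
Qed.

Lemma meanB X Y : X \in Lfun P 1 -> Y \in Lfun P 1 ->
  mean (fun w => X w - Y w) = mean X - mean Y.
Proof.
by move=> X1 Y1; rewrite /mean (expectationB X1 Y1) fineB ?expectation_fin_num.
Qed.

Lemma meanZ a X : X \in Lfun P 1 -> mean (fun w => a * X w) = a * mean X.
Proof.
move=> X1; rewrite /mean (_ : (fun w => a * X w) = a \o* X).
  by rewrite expectationZl// fineM ?expectation_fin_num.
by apply/funext => w /=; rewrite mulrC.
Qed.

Lemma mean_sum (m n : nat) (X : nat -> Omega -> R) :
  (forall i, X i \in Lfun P 2%:E) ->
  mean (fun w => \sum_(m <= i < n) X i w) = \sum_(m <= i < n) mean (X i).
Proof.
move=> X2; elim: n => [|n IH].
  rewrite (_ : (fun _ => _) = cst 0); last by apply/funext => w; rewrite big_geq.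
  by rewrite big_geq// /mean expectation_cst.
have [mn|nm] := leqP m n; last first.
  rewrite (_ : (fun _ => _) = cst 0); last by apply/funext => w; rewrite big_geq.
  by rewrite big_geq// /mean expectation_cst.
rewrite big_nat_recr//=; under eq_fun do rewrite big_nat_recr//=.
rewrite meanD ?IH//; apply: Lfun2_Lfun1 => //.
exact: Lfun2_sum.
Qed.

Lemma mean_sqr_le X : X \in Lfun P 2%:E ->
  mean X ^+ 2 <= mean (fun w => X w ^+ 2).
Proof.
move=> X2; have := var_ge0 X; rewrite /var varianceE// (meanE (Lfun2_Lfun1 X2)).
rewrite -[X in (X - _)%E]fineK; last exact: Lfun2_expectation.
by rewrite -EFin_expe -EFinB /= subr_ge0.
Qed.

End StandardDeviation.

(** * Dependence of the chains on their inputs, and invariance under time shifts *)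

Section ChainLaw.
Context {d : measure_display} {Omega : measurableType d} {R : realType}.
Variable P : probability Omega R.
Context {d1 : measure_display} {F : measurableType d1}
        {d2 : measure_display} {F' : measurableType d2}.
Variables (g : F * F' -> F) (U : int -> Omega -> F') (x0 : F).
Hypothesis mg : measurable_fun [set: F * F'] g.
Hypothesis mU : forall i, measurable_fun [set: Omega] (U i).
Hypothesis iidU : iid P U.

(** Being a function of the inputs indexed by [J] is expressed as measurability after re-equipping
    [Omega] with the generated sigma-algebra, so that general closure properties of measurable
    functions apply directly. *)
Definition determined_by {d3 : measure_display} {T : measurableType d3}
    (J : set int) (X : Omega -> T) : Prop :=
  measurable_fun setT (X : g_sigma_algebraType (preimages_on U J) -> T).

Lemma determined_byP {d3 : measure_display} {T : measurableType d3}
    (J : set int) (X : Omega -> T) (A : set T) :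
  determined_by J X -> measurable A -> <<s preimages_on U J >> (X @^-1` A).
Proof. by move=> JX mA; have := JX measurableT A mA; rewrite setTI. Qed.

Lemma determined_by_measurable {d3 : measure_display} {T : measurableType d3}
    (J : set int) (X : Omega -> T) :
  determined_by J X -> measurable_fun setT X.
Proof.
move=> JX _ A mA; rewrite setTI; apply: (sigma_on_measurable mU (J := J)).
exact: determined_byP.
Qed.

Lemma sub_determined_by {d3 : measure_display} {T : measurableType d3}
    (J K : set int) (X : Omega -> T) :
  J `<=` K -> determined_by J X -> determined_by K X.
Proof.
move=> JK JX _ A mA; rewrite setTI.
have := determined_byP JX mA; apply: sub_smallest2r.
  exact: smallest_sigma_algebra.
by move=> E [i Ji iE]; exists i => //; exact: JK.
Qed.

Lemma determined_by_indep {d3 d4 : measure_display}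
    {T : measurableType d3} {T' : measurableType d4}
    (J K : set int) (X : Omega -> T) (Y : Omega -> T') :
  J `&` K = set0 -> determined_by J X -> determined_by K Y ->
  independent P X Y.
Proof.
move=> JK JX KY A B mA mB.
by apply: (sigma_on_indep mU iidU.1 JK); exact: determined_byP.
Qed.

Lemma determined_by_comp {d3 d4 : measure_display}
    {T : measurableType d3} {T' : measurableType d4}
    (J : set int) (X : Omega -> T) (h : T -> T') :
  measurable_fun setT h -> determined_by J X ->
  determined_by J (fun w => h (X w)).
Proof. by move=> mh JX; apply: (measurableT_comp mh JX). Qed.

Lemma determined_by_pair {d3 d4 : measure_display}
    {T : measurableType d3} {T' : measurableType d4}
    (J : set int) (X : Omega -> T) (Y : Omega -> T') :
  determined_by J X -> determined_by J Y ->
  determined_by J (fun w => (X w, Y w)).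
Proof. by move=> JX JY; apply: (measurable_fun_pair JX JY). Qed.

Lemma determined_by_input (i : int) : determined_by [set i] (U i).
Proof.
move=> _ A mA; rewrite setTI; apply: sub_sigma_algebra.
by exists i => //; exists A => //; rewrite setTI.
Qed.

Lemma determined_by_chain_from (s : int) n :
  determined_by [set i | s <= i < s + n%:Z] (chain_from g U x0 s n).
Proof.
elim: n => [|n IH]; first exact: measurable_cst.
apply: (determined_by_comp mg); apply: determined_by_pair.
  apply: sub_determined_by IH => i /=; lia.
apply: sub_determined_by (@determined_by_input (s + n%:Z)).
by move=> i /= ->; lia.
Qed.

Lemma chain_from_measurable (s : int) n :
  measurable_fun setT (chain_from g U x0 s n).
Proof. exact: determined_by_measurable (@determined_by_chain_from s n). Qed.

(** Both coordinates are driven by the same new input, which is independent of the past and has the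
    same law at [t] and [t']. The law of the pair therefore propagates through one common step. *)
Lemma same_law_coupled_step (X X' : Omega -> F * F) (t t' : int) :
  determined_by [set i | i < t] X -> determined_by [set i | i < t'] X' ->
  same_law P X X' ->
  same_law P (fun w => (g ((X w).1, U t w), g ((X w).2, U t w)))
             (fun w => (g ((X' w).1, U t' w), g ((X' w).2, U t' w))).
Proof.
move=> tX t'X' XX'.
have disj (u : int) : [set i | i < u] `&` [set u] = set0.
  by apply/seteqP; split => // i [] /= iu ie; move: iu; rewrite ie ltxx.
have XU : same_law P (fun w => (X w, U t w)) (fun w => (X' w, U t' w)).
  apply: same_law_pair.
  - exact: determined_by_measurable tX.
  - exact: determined_by_measurable t'X'.
  - exact: mU.
  - exact: mU.
  - exact: determined_by_indep (disj t) tX (@determined_by_input t).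
  - exact: determined_by_indep (disj t') t'X' (@determined_by_input t').
  - exact: XX'.
  - exact: iidU.2.
pose h (z : (F * F) * F') := (g (z.1.1, z.2), g (z.1.2, z.2)).
apply: (same_law_comp (h := h)) XU.
by apply: measurable_fun_pair; apply: measurableT_comp => //;
  apply: measurable_fun_pair => //; apply: measurableT_comp.
Qed.

Lemma same_law_chain_from (s s' : int) n :
  same_law P (chain_from g U x0 s n) (chain_from g U x0 s' n).
Proof.
(* The chain is paired with itself so that the coupled step applies to a single chain. *)
pose D (u : int) w := (chain_from g U x0 u n w, chain_from g U x0 u n w).
suff : same_law P (D s) (D s').
  by move=> /(same_law_comp (h := fst)); apply.
rewrite /D; elim: n {D} => // n IH /=.
apply: same_law_coupled_step IH; apply: determined_by_pair;
  apply: sub_determined_by (@determined_by_chain_from _ _) => i /=; lia.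
Qed.

(** At [n = 0] the later chain still sits at [x0], and only the law of the earlier one, after [m]
    steps, matters. From then on both chains move with common inputs. *)
Lemma same_law_coupled (s s' : int) m n :
  same_law P
    (fun w => (chain_from g U x0 (s - m%:Z) (n + m) w, chain_from g U x0 s n w))
    (fun w => (chain_from g U x0 (s' - m%:Z) (n + m) w, chain_from g U x0 s' n w)).
Proof.
elim: n => [|n IH].
  apply: (same_law_comp (h := fun z => (z, x0))); last exact: same_law_chain_from.
  exact: measurable_fun_pair.
rewrite addSn /=.
have e u : u - m%:Z + (n + m)%N%:Z = u + n%:Z by lia.
rewrite !e; apply: same_law_coupled_step IH; apply: determined_by_pair;
  apply: sub_determined_by (@determined_by_chain_from _ _) => i /=; lia.
Qed.

Lemma shifted_chainE (i m : nat) :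
  shifted_chain g U x0 i%:Z m%:Z = chain_from g U x0 (- m%:Z) (i + m).
Proof. by rewrite /shifted_chain -PoszD. Qed.

Lemma chainE (i : nat) : chain g U x0 i = chain_from g U x0 0 i.
Proof.
apply/funext => w; rewrite -shifted_chain0.
by rewrite /shifted_chain addr0 oppr0.
Qed.

End ChainLaw.

(** * Recursive growth of block deviations, and elementary inequalities *)

Section BlockGrowth.
Context {R : realType}.
Variable s : nat -> R.
Hypothesis s_ge0 : forall j, 0 <= s j.

Let c (n : nat) : R := (Num.sqrt n%:R)^-1.

(** Bound for the deviation of a block of length [n] divided by [sqrt n]. The cost [s j] is paid at
    each dyadic scale beyond [j], with weight the inverse root of that scale; a geometric sum over
    the scales from [j + 1] to [n] is of the order of the difference of inverse roots below. *)
Definition growth (n : nat) : R :=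
  s 0%N + 9 / 2 * \sum_(0 <= j < n)
    s j * ((Num.sqrt j.+1%:R)^-1 - (Num.sqrt n%:R)^-1).

Lemma sqrtn_gt0 n : (0 < n)%N -> 0 < Num.sqrt n%:R :> R.
Proof. by move=> n0; rewrite sqrtr_gt0 ltr0n. Qed.

Let c_le m n : (0 < m)%N -> (m <= n)%N -> c n <= c m.
Proof.
move=> m0 mn; rewrite /c lef_pV2 ?posrE ?sqrtn_gt0// ?(leq_trans m0)//.
by rewrite ler_wsqrtr// ler_nat.
Qed.

Lemma growth_ge0 n : 0 <= growth n.
Proof.
rewrite /growth addr_ge0// mulr_ge0 ?divr_ge0// big_nat; apply: sumr_ge0 => j /= jn.
by rewrite mulr_ge0// subr_ge0; exact: c_le.
Qed.

Lemma growth_le m n : (0 < m)%N -> (m <= n)%N -> growth m <= growth n.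
Proof.
move=> m0 mn; rewrite /growth lerD2l ler_wpM2l ?divr_ge0//.
rewrite (big_cat_nat (n := m) (p := n))//= -[leLHS]addr0 lerD//.
  apply: ler_sum => j _; rewrite ler_wpM2l// lerD2l lerN2.
  exact: c_le.
rewrite big_nat; apply: sumr_ge0 => j /andP[mj jn].
by rewrite mulr_ge0// subr_ge0; exact: c_le.
Qed.

(* The factor [9/2] works because [(11/9)^2 <= 3/2 <= n/m], so that
   [11/9 * c n <= c m]. *)
Lemma growth_step m n : (0 < m)%N -> (3 * m <= 2 * n)%N ->
  growth m + (\sum_(0 <= j < m) s j) * (Num.sqrt n%:R)^-1 <= growth n.
Proof.
move=> m0 mn; have mn' : (m <= n)%N by lia.
rewrite /growth (big_cat_nat (n := m) (p := n))//= -addrA lerD2l.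
have key : 11 / 9 * c n <= c m.
  rewrite /c ler_pdivrMr ?sqrtn_gt0//; last by lia.
  rewrite [leRHS]mulrC ler_pdivlMr ?sqrtn_gt0// -[11 / 9]ger0_norm ?divr_ge0//.
  rewrite -sqrtr_sqr -sqrtrM ?sqr_ge0// ler_wsqrtr//.
  have : 3 * m%:R <= 2 * n%:R :> R by rewrite -!natrM ler_nat.
  have : 0 <= m%:R :> R by [].
  by lra.
have tail : 0 <= \sum_(m <= j < n) s j * (c j.+1 - c n).
  rewrite big_nat; apply: sumr_ge0 => j /andP[mj jn].
  by rewrite mulr_ge0// subr_ge0; exact: c_le.
have head : 9 / 2 * \sum_(0 <= j < m) s j * (c j.+1 - c m) +
    (\sum_(0 <= j < m) s j) * c n <= 9 / 2 * \sum_(0 <= j < m) s j * (c j.+1 - c n).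
  rewrite mulr_suml !mulr_sumr -big_split/=; apply: ler_sum => j _.
  have := ler_wpM2l (s_ge0 j) key; lra.
rewrite -/(c n) -/(c m) mulrDr; apply: le_trans head _.
by rewrite lerDl mulr_ge0// divr_ge0.
Qed.

(** Strong induction by halving. The index [i] is abstract, and the bound uniform in it, because the
    two halves of a block are blocks with other positions. *)
Lemma block_growth (I : Type) (sigma : I -> nat -> R) :
  (forall i n, 0 <= sigma i n) ->
  (forall i, sigma i 1%N <= s 0%N) ->
  (forall i n1 n2, (0 < n1)%N -> (0 < n2)%N -> exists i1 i2,
     sigma i (n1 + n2)%N <= Num.sqrt (sigma i1 n1 ^+ 2 + sigma i2 n2 ^+ 2)
                          + \sum_(0 <= j < n2) s j) ->
  forall n, (0 < n)%N -> forall i, sigma i n <= Num.sqrt n%:R * growth n.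
Proof.
move=> sg0 sg1 split; elim/ltn_ind => n IH n0 i.
have [n1|n1] := leqP n 1.
  have -> : n = 1%N by lia.
  rewrite sqrtr1 mul1r; apply: le_trans (sg1 i) _.
  by rewrite /growth lerDl big_nat1 sqrtr1 invr1 subrr !mulr0.
(* The first half is the longer one; [3 * m <= 2 * n] holds for every [n >= 2], with equality at
   [n = 3]. *)
pose n2 := n./2; pose m := (n - n2)%N.
have nE : n = (m + n2)%N by rewrite /m /n2; lia.
have [m0 n20] : (0 < m)%N /\ (0 < n2)%N by rewrite /m /n2; lia.
have [n2m mn] : (n2 <= m)%N /\ (m < n)%N by rewrite /m /n2; lia.
have [i1 [i2]] := split i m n2 m0 n20; rewrite -nE => /le_trans; apply.
have sgm := IH m mn m0 i1.
have sgn2 : sigma i2 n2 <= Num.sqrt n2%:R * growth m.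
  apply: le_trans (IH n2 _ n20 i2) _; first by lia.
  by rewrite ler_wpM2l ?sqrtr_ge0// growth_le.
(* Both halves obey the inductive bound with the same factor [growth m], and their lengths add up to
   [n]. *)
have root : Num.sqrt (sigma i1 m ^+ 2 + sigma i2 n2 ^+ 2) <= Num.sqrt n%:R * growth m.
  rewrite -[leRHS]ger0_norm ?mulr_ge0 ?sqrtr_ge0 ?growth_ge0// -sqrtr_sqr.
  rewrite ler_wsqrtr// exprMn sqr_sqrtr// nE natrD mulrDl.
  by apply: lerD; rewrite -[X in X * _]sqr_sqrtr// -exprMn ler_sqr// nnegrE
    ?mulr_ge0 ?sqrtr_ge0 ?growth_ge0.
have rs : \sum_(0 <= j < n2) s j <= \sum_(0 <= j < m) s j.
  by rewrite (big_cat_nat (n := n2) (p := m))//= lerDl sumr_ge0.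
apply: le_trans (lerD root rs) _.
have step : growth m + (\sum_(0 <= j < m) s j) * (Num.sqrt n%:R)^-1 <= growth n.
  by apply: growth_step => //; rewrite /m /n2; lia.
apply: le_trans (ler_wpM2l (sqrtr_ge0 n%:R) step).
by rewrite [leRHS]mulrDr lerD2l mulrCA mulfV ?mulr1// gt_eqF// sqrtn_gt0.
Qed.

(** The subtracted inverse roots are dropped, and [s 0] is itself the first term of the sum, whence
    [1 + 9/2 = 11/2]. *)
Lemma growth_bound (M : R) n : (0 < n)%N ->
  \sum_(0 <= j < n) s j / Num.sqrt j.+1%:R <= M -> growth n <= 11 / 2 * M.
Proof.
move=> n0 sM; have s0M : s 0%N <= M.
  apply: le_trans sM; rewrite big_ltn// sqrtr1 divr1 lerDl sumr_ge0// => j _.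
  by rewrite divr_ge0// sqrtr_ge0.
have : \sum_(0 <= j < n) s j * ((Num.sqrt j.+1%:R)^-1 - (Num.sqrt n%:R)^-1) <= M.
  apply: le_trans sM; apply: ler_sum => j _.
  by rewrite ler_wpM2l// gerBl invr_ge0 sqrtr_ge0.
by rewrite /growth; move: s0M; lra.
Qed.

End BlockGrowth.

(* [v] stands for the standard deviation of the average over the longer range,
   [w] for that of the difference between the two averages. *)
Lemma averaging_gap {R : realType} (k n n' del : nat) (sg v w : R) :
  (0 < k)%N -> (n = n' + del)%N -> (k <= 2 * n')%N -> (2 * del <= k)%N ->
  (n <= k)%N -> 0 <= sg -> 0 <= v -> 0 <= w ->
  v <= sg / Num.sqrt n%:R -> w <= 2 * sg * Num.sqrt del%:R / n%:R ->
  k%:R * ((v + w) ^+ 2 - v ^+ 2) <=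
    23 * sg ^+ 2 * Num.sqrt (del%:R / k%:R).
Proof.
move=> k0 nE kn' delk nk sg0 v0 w0 vle wle.
have n0 : (0 < n)%N by lia.
set x := Num.sqrt n%:R in vle; set y := Num.sqrt del%:R in wle.
have x0 : 0 < x by exact: sqrtn_gt0.
have y0 : 0 <= y by exact: sqrtr_ge0.
have xx : x ^+ 2 = n%:R by rewrite sqr_sqrtr.
have yx : y <= x by rewrite ler_wsqrtr// ler_nat; lia.
pose z : R := Num.sqrt k%:R.
have z0 : 0 < z by exact: sqrtn_gt0.
have zz : z ^+ 2 = k%:R by rewrite sqr_sqrtr.
have -> : Num.sqrt (del%:R / k%:R) = y / z by rewrite sqrtrM// sqrtrV.
rewrite -zz -xx in wle *.
have zx : z ^+ 2 <= 2 * x ^+ 2.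
  by rewrite zz xx -natrM ler_nat; lia.
(* The fraction [23/16] is a rational upper bound for the square root of 2: its square is
   [529/256]. *)
have zx' : z <= 23 / 16 * x.
  rewrite -(@ler_pXn2r _ 2)// ?nnegrE ?mulr_ge0 ?(ltW z0) ?(ltW x0)//.
  by rewrite exprMn; move: zx (sqr_ge0 x); lra.
have wle' : w <= 2 * sg / x.
  apply: le_trans wle _; rewrite ler_pdivrMr ?exprn_gt0// expr2 mulrA divfK ?gt_eqF//.
  by rewrite ler_wpM2l// mulr_ge0.
have step : (v + w) ^+ 2 - v ^+ 2 <= (2 * sg * y / x ^+ 2) * (4 * sg / x).
  rewrite (_ : _ - _ = w * (2 * v + w)); last by ring.
  apply: ler_pM => //; first by rewrite addr_ge0// mulr_ge0.
  rewrite (_ : 4 * sg / x = 2 * (sg / x) + 2 * sg / x); last by ring.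
  by rewrite lerD// ler_wpM2l.
apply: le_trans (ler_wpM2l (sqr_ge0 z) step) _.
have -> : z ^+ 2 * (2 * sg * y / x ^+ 2 * (4 * sg / x)) =
    8 * (sg ^+ 2 * (y / z)) * (z / x) ^+ 3.
  by field; rewrite !gt_eqF.
(* The cube is bounded by [2 * 23/16]; with the prefactor 8 this gives the constant 23. *)
have zx3 : (z / x) ^+ 3 <= 23 / 8.
  have zx0 : 0 <= z / x by rewrite divr_ge0 ?ltW.
  have zx1 : z / x <= 23 / 16 by rewrite ler_pdivrMr.
  have zx2 : (z / x) ^+ 2 <= 2.
    by rewrite expr_div_n ler_pdivrMr ?exprn_gt0.
  rewrite exprS (_ : 23 / 8 = (23 / 16) * 2); last by field.
  by rewrite ler_pM// sqr_ge0.
have q0 : 0 <= sg ^+ 2 * (y / z) by rewrite mulr_ge0 ?sqr_ge0// divr_ge0// ltW.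
rewrite (_ : 23 * sg ^+ 2 * (y / z) = 8 * (sg ^+ 2 * (y / z)) * (23 / 8)); last by field; rewrite gt_eqF.
by rewrite ler_wpM2l// mulr_ge0.
Qed.

Lemma nneseries_partial {R : realType} (u : nat -> R) (j n : nat) :
  (forall i, 0 <= u i) -> (\sum_(0 <= i <oo) (u i)%:E < +oo)%E ->
  \sum_(j <= i < n) u i <= fine (\sum_(j <= i <oo) (u i)%:E)%E.
Proof.
move=> u0 ufin; rewrite -lee_fin -sumEFin.
have uE i : (0 <= (u i)%:E)%E by rewrite lee_fin.
have jfin : (\sum_(j <= i <oo) (u i)%:E < +oo)%E.
  apply: le_lt_trans ufin; rewrite (@nneseries_split _ _ 0 j)// leeDr//.
  exact: sume_ge0.
rewrite fineK; first exact: nneseries_lim_ge.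
by rewrite ge0_fin_numE//; exact: nneseries_ge0.
Qed.

(** Cauchy-Schwarz by induction. The new cross term [2 * S * y] is controlled by the nonnegative
    square [(S - x * y)^2], where [x] is the previous number of terms. *)
Lemma sqr_sum_le {R : realType} (m n : nat) (a : nat -> R) :
  (\sum_(m <= i < n) a i) ^+ 2 <= (n - m)%:R * \sum_(m <= i < n) a i ^+ 2.
Proof.
elim: n => [|n IH]; first by rewrite !big_geq// expr0n mulr0.
have [nm|mn] := ltnP n m; first by rewrite !big_geq// expr0n mulr0.
rewrite !big_nat_recr//= subSn// -natr1.
move: IH; have [->|mn'] := eqVneq n m.
  by rewrite !big_geq// subnn !add0r mul1r.
set S := \sum_(m <= i < n) a i; set Q := \sum_(m <= i < n) _.
have d0 : 0 < (n - m)%:R :> R by rewrite ltr0n subn_gt0 ltn_neqAle eq_sym mn'.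
move: (n - m)%:R d0 (a n) => x x0 y IH.
suff : 2 * S * y <= Q + x * y ^+ 2 by move: IH; lra.
rewrite -(ler_pM2l x0).
have := sqr_ge0 (S - x * y); move: IH; nra.
Qed.

(** * Coupling bounds, variance of blocks and convergence of means *)

Section ChainMoments.
Context {d : measure_display} {Omega : measurableType d} {R : realType}.
Variable P : probability Omega R.
Context {d1 : measure_display} {F : measurableType d1}
        {d2 : measure_display} {F' : measurableType d2}.
Variables (g : F * F' -> F) (U : int -> Omega -> F') (x0 : F) (f : F -> R).
Hypothesis mg : measurable_fun [set: F * F'] g.
Hypothesis mU : forall i, measurable_fun [set: Omega] (U i).
Hypothesis iidU : iid P U.
Hypothesis mf : measurable_fun [set: F] f.
Hypothesis f_L2 : forall i : nat, (fun w => f (chain g U x0 i w)) \in Lfun P 2%:E.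
Variable nu : nat -> R.
Hypothesis nu_bound : forall i m : nat,
  ('E_P[fun w => ((f (shifted_chain g U x0 i%:Z m%:Z w)
                   - f (chain g U x0 i w)) ^+ 2)%R] <= (nu i)%:E)%E.

Definition fchain (s : int) (n : nat) (w : Omega) : R :=
  f (chain_from g U x0 s n w).

Lemma fchain_determined (s : int) n :
  determined_by U [set i | s <= i < s + n%:Z] (fchain s n).
Proof.
have := @determined_by_chain_from _ _ _ _ _ _ g U x0 mg s n.
exact: determined_by_comp.
Qed.

Lemma fchain_measurable (s : int) n : measurable_fun setT (fchain s n).
Proof. exact: determined_by_measurable (@fchain_determined s n). Qed.

Lemma fchain_same_law (s s' : int) n : same_law P (fchain s n) (fchain s' n).
Proof. exact: (same_law_comp mf (same_law_chain_from x0 mg mU iidU s s' n)). Qed.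

Lemma fchain_Lfun2 (s : int) n : fchain s n \in Lfun P 2%:E.
Proof.
have := f_L2 n; rewrite chainE; apply: same_law_Lfun2.
  exact: fchain_measurable.
exact: (fchain_same_law 0 s).
Qed.

Lemma fchain_mean (s s' : int) n : mean P (fchain s n) = mean P (fchain s' n).
Proof.
rewrite /mean; congr fine.
apply: (same_law_expectation (h := fun x : R => x)) => //.
- exact: fchain_measurable.
- exact: fchain_measurable.
- exact: fchain_same_law.
Qed.

(** The joint law of the two chains does not depend on [s], and at [s = 0] the bound is the
    hypothesis on [nu]. *)
Lemma fchain_coupling (s : int) m n :
  mean P (fun w => (fchain (s - m%:Z) (n + m) w - fchain s n w) ^+ 2) <= nu n.
Proof.
have L2 : (fun w => fchain (s - m%:Z) (n + m) w - fchain s n w) \in Lfun P 2%:E.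
  by apply: Lfun2B; exact: fchain_Lfun2.
rewrite -lee_fin /mean (fineK (Lfun2_expectation L2)).
have := nu_bound n m; rewrite shifted_chainE chainE.
pose h (z : F * F) : R := (f z.1 - f z.2) ^+ 2.
have mh : measurable_fun setT h.
  by apply: measurable_funX; apply: measurable_funB; apply: measurableT_comp.
have mc t t' m' n' : measurable_fun setT
    (fun w => (chain_from g U x0 t m' w, chain_from g U x0 t' n' w)).
  by apply: measurable_fun_pair; exact: chain_from_measurable.
have := same_law_expectation (mc _ _ _ _) (mc _ _ _ _) mh
  (same_law_coupled x0 mg mU iidU s 0 m n).
by rewrite /comp /h /= sub0r => <-.
Qed.

Lemma sd_fchain_coupling (s : int) m n :
  sd P (fun w => fchain (s - m%:Z) (n + m) w - fchain s n w) <= Num.sqrt (nu n).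
Proof.
rewrite ler_wsqrtr//; apply: le_trans (fchain_coupling s m n).
by apply: var_le_sqr; apply: Lfun2B; exact: fchain_Lfun2.
Qed.

(** Coupling with a chain started at the very time of observation compares with the constant [f x0],
    which does not affect the variance. *)
Lemma sd_fchain (s : int) n : sd P (fchain s n) <= Num.sqrt (nu 0%N).
Proof.
have := sd_fchain_coupling (s + n%:Z) n 0; rewrite addrK add0n.
rewrite [X in sd P X](_ : _ = fchain s n \- cst (f x0))//.
by rewrite /sd /var varianceB_cst_r//; exact: fchain_Lfun2.
Qed.

Definition block (s : int) (m n : nat) (w : Omega) : R :=
  \sum_(0 <= i < n) fchain s (m + i) w.

Lemma block_Lfun2 s m n : block s m n \in Lfun P 2%:E.
Proof. by apply: (Lfun2_sum 0 n (X := fun i => fchain s (m + i))) => i; exact: fchain_Lfun2. Qed.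

Lemma block_determined (s : int) m n (J : set int) :
  (forall i, (i < n)%N -> [set j | s <= j < s + (m + i)%N%:Z] `<=` J) ->
  determined_by U J (block s m n).
Proof.
rewrite /block; elim: n => [|n IH] sJ.
  rewrite (_ : (fun _ => _) = cst 0); first exact: measurable_cst.
  by apply/funext => w; rewrite big_geq.
rewrite (_ : (fun _ => _) = fun w => block s m n w + fchain s (m + n) w); last first.
  by apply/funext => w; rewrite big_nat_recr.
apply: (@measurable_funD _ (g_sigma_algebraType (preimages_on U J)) R setT
  (block s m n) (fchain s (m + n))).
  by apply: IH => i ni; apply: sJ; lia.
apply: sub_determined_by (@fchain_determined s (m + n)%N).
by apply: sJ; lia.
Qed.

(* The second block is compared with the same block of a chain restarted at the
   junction, which is independent of the first block. *)
Lemma sd_block_split (s : int) m n1 n2 :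
  sd P (block s m (n1 + n2)) <=
  Num.sqrt (sd P (block s m n1) ^+ 2 +
            sd P (block (s + (m + n1)%N%:Z) 0 n2) ^+ 2)
  + \sum_(0 <= j < n2) Num.sqrt (nu j).
Proof.
set s2 := s + (m + n1)%N%:Z.
(* Discrepancy between the original and the restarted chain, [i] steps after the restart; its
   deviation is at most [sqrt (nu i)]. *)
pose D i w := fchain (s2 - (m + n1)%N%:Z) (i + (m + n1)) w - fchain s2 i w.
have D2 i : D i \in Lfun P 2%:E by apply: Lfun2B; exact: fchain_Lfun2.
have -> : block s m (n1 + n2) =
    fun w => (block s m n1 w + block s2 0 n2 w) + \sum_(0 <= i < n2) D i w.
  apply/funext => w; rewrite /block (big_cat_nat (n := n1))//=; last by lia.
  rewrite -addrA; congr (_ + _).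
  rewrite -{1}[n1]add0n big_addn addKn -big_split/=; apply: eq_bigr => i _.
  rewrite /D add0n addrC subrK /s2 addrK; congr (fchain _ _ _); lia.
have B12 : (fun w => block s m n1 w + block s2 0 n2 w) \in Lfun P 2%:E.
  by apply: Lfun2D; exact: block_Lfun2.
apply: le_trans (sdD B12 (Lfun2_sum 0 n2 D2)) _; apply: lerD.
  rewrite !sd_sqr /sd var_indepD//; [exact: block_Lfun2|exact: block_Lfun2|].
  (* The first block uses only inputs before time [s2], the restarted one only inputs from [s2]
     on. *)
  apply: (@determined_by_indep _ _ _ P _ _ U mU iidU _ _ _ _
    [set i | i < s2] [set i | s2 <= i]).
  - by apply/seteqP; split => // i [] /=; rewrite ltNge => /negP.
  - by apply: block_determined => i ni j /=; rewrite /s2; lia.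
  - by apply: block_determined => i ni j /=; rewrite /s2; lia.
apply: le_trans (sd_sum n2 D2) _; apply: ler_sum => i _.
exact: sd_fchain_coupling.
Qed.

Lemma sd_block (M : R) :
  (forall n, \sum_(0 <= j < n) Num.sqrt (nu j) / Num.sqrt j.+1%:R <= M) ->
  forall s m n, sd P (block s m n) <= 11 / 2 * M * Num.sqrt n%:R.
Proof.
move=> hM s m [|n].
  rewrite sqrtr0 mulr0 (_ : block s m 0 = cst 0).
    by rewrite /sd /var variance_cst sqrtr0.
  by apply/funext => w; rewrite /block big_geq.
pose sigma (i : int * nat) n := sd P (block i.1 i.2 n).
have := @block_growth R (fun j => Num.sqrt (nu j)) (fun j => sqrtr_ge0 _)
  (int * nat)%type sigma _ _ _ n.+1 isT (s, m).
rewrite /sigma /= => /(_ _ _ _)/le_trans; apply.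
- by move=> *; exact: sd_ge0.
- move=> [s' m'] /=; rewrite (_ : block s' m' 1 = fchain s' m') ?sd_fchain//.
  by apply/funext => w; rewrite /block big_nat1 addn0.
- move=> [s' m'] n1 n2 _ _; exists (s', m'), (s' + (m' + n1)%N%:Z, 0%N).
  exact: sd_block_split.
- by rewrite mulrC ler_wpM2r ?sqrtr_ge0//; apply: growth_bound.
Qed.

Lemma mean_fchain_gap h m :
  `|mean P (fchain 0 (h + m)) - mean P (fchain 0 h)| <= Num.sqrt (nu h).
Proof.
rewrite (fchain_mean 0 (0 - m%:Z)) -sqrtr_sqr ler_wsqrtr//.
have [L1 L2] := (fchain_Lfun2 (0 - m%:Z) (h + m), fchain_Lfun2 0 h).
rewrite -meanB ?Lfun2_Lfun1//; apply: le_trans (fchain_coupling 0 m h).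
by apply: mean_sqr_le; exact: Lfun2B.
Qed.

(** The intervals centred at the means with radii [sqrt (nu h)] meet pairwise, so the supremum of
    their left endpoints belongs to all of them. *)
Lemma mean_fchain_limit : exists mu : R, forall h,
  `|mean P (fchain 0 h) - mu| <= Num.sqrt (nu h).
Proof.
pose e h := mean P (fchain 0 h).
have le h j : e h - Num.sqrt (nu h) <= e j + Num.sqrt (nu j).
  have gap a b : (a <= b)%N -> `|e b - e a| <= Num.sqrt (nu a).
    by move=> ab; have := mean_fchain_gap a (b - a); rewrite subnKC.
  rewrite lerBlDr -lerBlDl.
  have [hj|jh] := leqP h j.
    have := gap _ _ hj; rewrite ler_norml => /andP[+ _].
    by have := sqrtr_ge0 (nu j); lra.
  have := gap _ _ (ltnW jh); rewrite ler_norml => /andP[_ +].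
  by have := sqrtr_ge0 (nu h); lra.
pose A := [set e h - Num.sqrt (nu h) | h in [set: nat]].
have supA : has_sup A.
  split; first by exists (e 0%N - Num.sqrt (nu 0%N)), 0%N.
  by exists (e 0%N + Num.sqrt (nu 0%N)) => _ [h _ <-]; exact: le.
exists (sup A) => h; rewrite -/(e h) ler_distlC; apply/andP; split.
  by apply: (sup_upper_bound supA); exists h.
by apply: ge_sup; [case: supA|move=> _ [j _ <-]; exact: le].
Qed.

End ChainMoments.

(** * Level probabilities and the weighted sum over levels *)

Section LevelSums.
Context {R : realType}.
Variables (nu : nat -> R) (theta : R -> R).
Hypothesis nu_gt0 : forall i, 0 < nu i.
Hypothesis nu_decr : nonincreasing_seq nu.
Hypothesis theta_incr : forall x y : R, 0 <= x -> x <= y -> theta x <= theta y.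
Hypothesis theta1 : forall x : R, 0 <= x <= 1 -> theta x = 1.

Lemma theta_ge1 x : 0 <= x -> 1 <= theta x.
Proof. by move=> x0; rewrite -(theta1 (x := 0)) ?lexx ?ler01// theta_incr. Qed.

Lemma theta_nat_gt0 l : 0 < theta l%:R.
Proof. by apply: lt_le_trans (theta_ge1 _). Qed.

(** As [theta] increases, the subtracted term is at most half of the first one. *)
Lemma level_prob_ge l : (theta l%:R * 2 ^+ l.+1)^-1 <= level_prob theta l.
Proof.
rewrite /level_prob !div1r.
have t0 := theta_nat_gt0 l; have p0 : 0 < 2 ^+ l :> R by rewrite exprn_gt0.
have : (theta l.+1%:R * 2 ^+ l.+1)^-1 <= (theta l%:R * 2 ^+ l.+1)^-1.
  rewrite lef_pV2 ?posrE ?mulr_gt0 ?exprn_gt0 ?theta_nat_gt0//.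
  by rewrite ler_wpM2r ?exprn_ge0// theta_incr// ler_nat.
have -> : (theta l%:R * 2 ^+ l)^-1 = 2 * (theta l%:R * 2 ^+ l.+1)^-1.
  by rewrite exprS; field; rewrite !gt_eqF.
by lra.
Qed.

Lemma level_prob_gt0 l : 0 < level_prob theta l.
Proof.
apply: lt_le_trans (level_prob_ge l).
by rewrite invr_gt0 mulr_gt0 ?exprn_gt0 ?theta_nat_gt0.
Qed.

Lemma level_prob_le l : level_prob theta l <= (theta l%:R * 2 ^+ l)^-1.
Proof.
by rewrite /level_prob !div1r gerBl invr_ge0 mulr_ge0 ?exprn_ge0// ltW// theta_nat_gt0.
Qed.

Lemma div_level_prob_le l (x : R) : 0 <= x ->
  x / level_prob theta l <= x * (theta l%:R * 2 ^+ l.+1).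
Proof.
move=> x0; rewrite ler_wpM2l// -[leRHS]invrK lef_pV2 ?posrE ?level_prob_gt0//.
  exact: level_prob_ge.
by rewrite invr_gt0 mulr_gt0 ?exprn_gt0 ?theta_nat_gt0.
Qed.

Lemma le_log2 (l n : nat) : (2 ^ l <= n)%N -> l%:R <= log2 n%:R :> R.
Proof.
move=> ln; have n0 : (0 < n)%N by apply: leq_trans ln; rewrite expn_gt0.
rewrite /log2 ler_pdivlMr; last by rewrite ln_gt0// ltr1n.
rewrite mulrC mulr_natr.
by rewrite -lnXn// ler_ln ?posrE ?exprn_gt0 ?ltr0n// -natrX ler_nat.
Qed.

Hypothesis theta_sum : (nu_bar_theta nu theta 0 < +oo)%E.

Let u (i : nat) : R :=
  Num.sqrt (nu i * theta (log2 (4 * i + 1)%:R) / i.+1%:R).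

Let u_ge0 i : 0 <= u i. Proof. exact: sqrtr_ge0. Qed.

Lemma nu_theta_partial h m n : (h <= m)%N ->
  \sum_(m <= i < n) u i <= fine (nu_bar_theta nu theta h).
Proof.
move=> hm; apply: le_trans (nneseries_partial h n u_ge0 theta_sum).
have [mn|nm] := leqP m n; last by rewrite big_geq ?sumr_ge0// ltnW.
by rewrite [leRHS](big_cat_nat (n := m))//= lerDr sumr_ge0.
Qed.

Lemma nu_theta_ge (l i K m : nat) : (2 ^ l <= 4 * i + 1)%N -> (i <= K)%N ->
  (i < m)%N -> Num.sqrt (nu K * theta l%:R / m%:R) <= u i.
Proof.
move=> li iK im; rewrite ler_wsqrtr//.
have t0 := ltW (theta_nat_gt0 l).
apply: ler_pM; rewrite ?invr_ge0 ?mulr_ge0 ?(ltW (nu_gt0 _))//.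
  apply: ler_pM; rewrite ?(ltW (nu_gt0 _))//; first exact: nu_decr.
  by rewrite theta_incr// le_log2.
by rewrite lef_pV2 ?posrE ?ltr0n ?ler_nat//; lia.
Qed.

Lemma sum_nu_theta_ge (a b : nat) (r : R) : (forall i, (a <= i < b)%N -> r <= u i) ->
  (b - a)%:R * r <= \sum_(a <= i < b) u i.
Proof.
move=> ru; rewrite mulr_natl -sumr_const_nat big_nat [leRHS]big_nat.
by apply: ler_sum.
Qed.

Variables (k b' : nat).
Hypotheses (k0 : (0 < k)%N) (hb' : (2 * b' <= k)%N).

(** [K l] is the least number of steps taken by a chain entering the level [l] average. [T l] is the
    part of the series carried by the [k * 2 ^ l] indices in [(K l, K (l + 1)]]. *)
Let S := fine (nu_bar_theta nu theta b'./2).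
Let T0 := \sum_(b' <= i < k) u i.
Let K l := (k * (2 ^ l - 1) + b')%N.
Let T l := \sum_((K l).+1 <= i < (K l.+1).+1) u i.

Let K_half l : (b'./2 <= (K l).+1)%N.
Proof. by rewrite /K; move: (k * _)%N => x; clear; lia. Qed.

Let K_lt l : (K l < k * 2 ^ l)%N.
Proof.
rewrite /K; have : (0 < 2 ^ l)%N by rewrite expn_gt0.
by move: (2 ^ l)%N k0 hb'; clear; nia.
Qed.

Let K_block l : ((K l.+1).+1 - (K l).+1 = k * 2 ^ l)%N.
Proof.
rewrite /K expnS; have : (0 < 2 ^ l)%N by rewrite expn_gt0.
by move: (2 ^ l)%N; clear; nia.
Qed.

Let K_le l : (K l <= K l.+1)%N.
Proof.
rewrite /K expnS; have : (0 < 2 ^ l)%N by rewrite expn_gt0.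
by move: (2 ^ l)%N; clear; nia.
Qed.

Let K_pow l i : (K l < i)%N -> (2 ^ l.+1 <= 4 * i + 1)%N.
Proof.
rewrite /K expnS; have : (0 < 2 ^ l)%N by rewrite expn_gt0.
by move: (2 ^ l)%N k0; clear; nia.
Qed.

Let S_ge0 : 0 <= S.
Proof.
by apply: le_trans (nu_theta_partial 0 (leqnn _)); rewrite big_geq.
Qed.

(** Here [p_0 = 1/2], and [k <= 2 * (k - b')]. Write [nu i = r^2 * (i + 1)]: each [u j] with
    [j <= i] is at least [r], and at least half of these indices are beyond [b'/2], so
    [(i + 1) * r <= 2 * S]. The remaining factor [r] is at most [u i]. *)
Let first_level e :
  e <= (k - b')%:R^-1 * \sum_(b' <= i < k) nu i ->
  k%:R * (e / level_prob theta 0) <= 8 * S * T0.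
Proof.
move=> he; have sum0 : 0 <= \sum_(b' <= i < k) nu i.
  by apply: sumr_ge0 => i _; exact: ltW.
have d0 : 0 < (k - b')%:R :> R by rewrite ltr0n; lia.
have p2 : level_prob theta 0 = 2^-1.
  rewrite /level_prob !theta1 ?lexx ?ler01//.
  by rewrite expr0 expr1; field.
rewrite p2 invrK.
have step : k%:R * (e * 2) <= 4 * \sum_(b' <= i < k) nu i.
  have kd : k%:R <= 2 * (k - b')%:R :> R by rewrite -natrM ler_nat; lia.
  have : k%:R * e <= 2 * \sum_(b' <= i < k) nu i.
    apply: le_trans (ler_wpM2l (ler0n _ _) he) _; rewrite mulrA ler_wpM2r//.
    by rewrite ler_pdivrMr.
  by lra.
apply: le_trans step _.
rewrite (_ : 8 * S * T0 = 4 * (2 * S * T0)); last by ring.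
rewrite ler_wpM2l// /T0 mulr_sumr big_nat [leRHS]big_nat.
apply: ler_sum => i /andP[bi ik].
pose r := Num.sqrt (nu i / i.+1%:R).
have r0 : 0 <= r by exact: sqrtr_ge0.
have rr : r ^+ 2 * i.+1%:R = nu i.
  by rewrite sqr_sqrtr ?divr_ge0 ?(ltW (nu_gt0 _))// divfK// pnatr_eq0.
have ru j : (j <= i)%N -> r <= u j.
  move=> ji; have := @nu_theta_ge 0 j i i.+1.
  by rewrite theta1 ?lexx ?ler01// mulr1; apply; lia.
have rS : (i.+1 - b'./2)%:R * r <= S.
  apply: le_trans (nu_theta_partial i.+1 (leqnn _)).
  by apply: sum_nu_theta_ge => j /andP[_ ji]; exact: ru.
have half : i.+1%:R <= 2 * (i.+1 - b'./2)%:R :> R by rewrite -natrM ler_nat; lia.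
have : i.+1%:R * r <= 2 * S.
  by apply: le_trans (ler_wpM2r r0 half) _; rewrite -mulrA ler_wpM2l.
move=> /(ler_wpM2r r0) irS; apply: le_trans (_ : _ <= 2 * S * r) _.
  by rewrite -rr expr2 mulrC mulrA.
by rewrite ler_wpM2l ?mulr_ge0// ru.
Qed.

(** All terms averaged in the bound for [e] are at most [nu (K (l + 1))]. The weighted quantity is
    then at most 8 times the square of a lower bound for [T l], and one of the two factors [T l] is
    replaced by [S]. *)
Let next_level l e : 0 <= e ->
  e <= (k - b')%:R^-1 * \sum_(b' <= i < k) nu (i + k * (2 ^ l.+1 - 1)) ->
  k%:R * (e / level_prob theta l.+1) <= 8 * S * T l.
Proof.
move=> e0 he; have d0 : 0 < (k - b')%:R :> R by rewrite ltr0n; lia.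
have enu : e <= nu (K l.+1).
  apply: le_trans he _; rewrite ler_pdivrMl//.
  rewrite mulr_natl -sumr_const_nat big_nat [leRHS]big_nat.
  by apply: ler_sum => i /andP[bi ik]; apply: nu_decr; rewrite /K; lia.
set t := theta l.+1%:R; set v := nu (K l.+1) in enu *.
have [t0 v0] : 0 < t /\ 0 < v by split; [exact: theta_nat_gt0|exact: nu_gt0].
pose r := Num.sqrt (v * t / (k * 2 ^ l.+1)%:R).
have r0 : 0 <= r by exact: sqrtr_ge0.
have kl0 : 0 < (k * 2 ^ l)%:R :> R by rewrite ltr0n muln_gt0 k0 expn_gt0.
(* Indices [i] in this range satisfy [2^(l+1) <= 4*i + 1] and [i < k * 2^(l+1)], so each of the
   [k * 2^l] terms is at least [r]. *)
have rT : (k * 2 ^ l)%:R * r <= T l.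
  rewrite -K_block; apply: sum_nu_theta_ge => i /andP[Ki iK].
  apply: nu_theta_ge; [exact: K_pow Ki|by rewrite -ltnS|].
  exact: leq_trans iK (K_lt _).
have TS : T l <= S by apply: nu_theta_partial; exact: K_half.
have T0' : 0 <= T l by apply: sumr_ge0 => i _; exact: u_ge0.
have step : k%:R * (e / level_prob theta l.+1) <= 8 * ((k * 2 ^ l)%:R * r) ^+ 2.
  have -> : 8 * ((k * 2 ^ l)%:R * r) ^+ 2 = k%:R * (v * (t * 2 ^+ l.+2)).
    rewrite exprMn sqr_sqrtr; last by rewrite divr_ge0 ?mulr_ge0 ?(ltW v0) ?(ltW t0).
    rewrite expnS !natrM natrX !exprS; field.
    by rewrite pnatr_eq0 -lt0n k0 expf_neq0.
  rewrite ler_wpM2l//; apply: le_trans (div_level_prob_le _ e0) _.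
  by apply: ler_wpM2r enu; apply: mulr_ge0 (ltW t0) (exprn_ge0 _ _).
apply: le_trans step _; rewrite -mulrA ler_wpM2l// expr2.
have kr0 : 0 <= (k * 2 ^ l)%:R * r by rewrite mulr_ge0.
by apply: ler_pM => //; exact: le_trans TS.
Qed.

Lemma level_sum_le (e : nat -> R) n : (forall l, 0 <= e l) ->
  (forall l, e l <= (k - b')%:R^-1 *
     \sum_(b' <= i < k) nu (i + k * (2 ^ l - 1))) ->
  k%:R * \sum_(0 <= l < n) e l / level_prob theta l <= 16 * S ^+ 2.
Proof.
move=> e0 he.
have terms : k%:R * \sum_(0 <= l < n.+1) e l / level_prob theta l <=
    8 * S * (T0 + \sum_(0 <= l < n) T l).
  have -> : 8 * S * (T0 + \sum_(0 <= l < n) T l) =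
      8 * S * T0 + \sum_(0 <= l < n) 8 * S * T l.
    by rewrite mulrDr; congr (_ + _); rewrite mulr_sumr.
  rewrite [leLHS]mulr_sumr big_nat_recl//; apply: lerD.
    apply: first_level; apply: le_trans (he 0%N) _.
    by rewrite expn0 subnn muln0; under eq_bigr do rewrite addn0.
  by apply: ler_sum => l _; exact: next_level.
(* The range of [T0] may overlap those of the [T l], so [T0] and the sum of the [T l] are each
   bounded by [S]; hence [8 * S * (S + S)]. *)
have T0S : T0 <= S by apply: nu_theta_partial; lia.
have TS : \sum_(0 <= l < n) T l <= S.
  have -> : \sum_(0 <= l < n) T l = \sum_((K 0).+1 <= i < (K n).+1) u i.
    elim: n {terms} => [|n IH]; first by rewrite !big_geq.
    have K0n : (K 0 <= K n)%N by elim: n {IH} => // n /leq_trans; apply.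
    by rewrite big_nat_recr//= IH [RHS](big_cat_nat (n := (K n).+1))//= ltnS.
  by apply: nu_theta_partial; exact: K_half.
apply: le_trans (_ : _ <= 8 * S * (S + S)) _; last by rewrite expr2; lra.
apply: le_trans (_ : _ <= 8 * S * (T0 + \sum_(0 <= l < n) T l)) _; last first.
  by rewrite ler_wpM2l ?mulr_ge0// lerD.
apply: le_trans terms; rewrite ler_wpM2l// big_nat_recr//= lerDl.
by rewrite divr_ge0// ltW// level_prob_gt0.
Qed.

End LevelSums.

(** * Moments of a sum estimated by one randomly chosen term *)

Section Randomized.
Context {d : measure_display} {Omega : measurableType d} {R : realType}.
Variable P : probability Omega R.
Context {d2 : measure_display} {F' : measurableType d2}.
Variable U : int -> Omega -> F'.
Variables (N : {RV P >-> nat}) (p : nat -> R) (D : nat -> Omega -> R).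
Hypothesis p_gt0 : forall l, 0 < p l.
Hypothesis N_law : forall l : nat, P (N @^-1` [set l]) = (p l)%:E.
Hypothesis N_indep : independent_of_family P N U.
Hypothesis D_L2 : forall l, D l \in Lfun P 2%:E.
Hypothesis D_det : forall l, determined_by U setT (D l).

Definition randomized (w : Omega) : R := D (N w) w / p (N w).

Let event (l : nat) : set Omega := N @^-1` [set l].

Let mevent l : measurable (event l).
Proof. by rewrite /event -[_ @^-1` _]setTI; exact: measurable_funP. Qed.

Let cover_event : \bigcup_l event l = setT.
Proof. by apply/seteqP; split => // w _; exists (N w). Qed.

Let triv_event : trivIset setT event.
Proof. by move=> i j _ _ [w [/= <- <-]]. Qed.

Lemma randomized_measurable : measurable_fun setT randomized.
Proof.
rewrite -cover_event; apply/measurable_fun_bigcup => // l.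
apply: (@eq_measurable_fun _ _ _ _ _ (fun w => D l w / p l)).
  by move=> w; rewrite inE /event /= /randomized => ->.
apply: measurable_funTS; apply: measurable_funM => //.
exact: Lfun_measurable (D_L2 l).
Qed.

(** The indicator of [N = l] is independent of [Y], which depends on the inputs only, so the
    expectation of their product factors. *)
Lemma integral_event l (Y : Omega -> R) : Y \in Lfun P 1 ->
  determined_by U setT Y ->
  (\int[P]_(w in event l) (Y w)%:E = (p l * mean P Y)%:E)%E.
Proof.
move=> Y1 Ydet; pose X : Omega -> R := \1_(event l).
have EX : ('E_P[X] = (p l)%:E)%E by rewrite expectation_indic// N_law.
have X2 : X \in Lfun P 2%:E.
  apply: Lfun2P; first exact: measurable_indic.
  rewrite (_ : (fun w => X w ^+ 2) = X) ?EX ?ltry//.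
  by apply/funext => w; rewrite /X indicE; case: (_ \in _); rewrite ?expr1n ?expr0n.
have XY : independent P X Y.
  move=> A B mA mB.
  (* An event about the indicator is rewritten as an event about [N], the form in which independence
     is assumed. *)
  rewrite (_ : X @^-1` A = N @^-1` [set n | A (n == l)%:R]); last first.
    apply/seteqP; split => w; rewrite /= /X indicE /event;
    by have [e|e] := eqVneq (N w) l; [rewrite mem_set|rewrite memNset//; exact/eqP].
  by apply: N_indep => //; exact: determined_byP Ydet mB.
have [_ EXY] := independent_expectationM (Lfun2_Lfun1 X2) Y1 XY.
rewrite EFinM -EX -(meanE Y1) -EXY unlock integral_mkcond.
apply: eq_integral => w _; rewrite patchE /= /X indicE.
by case: (_ \in _); rewrite ?mul1r ?mul0r.
Qed.

(** On [N = l] the square is that of [D l] over [p l ^ 2], and the event contributes a factor [p l].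
    By nonnegativity the identity holds in the extended reals, so it can serve to prove
    square-integrability. *)
Lemma expectation_randomized_sqr :
  ('E_P[fun w => (randomized w ^+ 2)%R] =
   \sum_(0 <= l <oo) (mean P (fun w => D l w ^+ 2) / p l)%:E)%E.
Proof.
rewrite unlock -cover_event ge0_integral_bigcup//; last 2 first.
- rewrite cover_event; apply/measurable_EFinP; apply: measurable_funX.
  exact: randomized_measurable.
- by move=> w _; rewrite lee_fin sqr_ge0.
apply: eq_eseriesr => l _.
have D1 : (fun w => D l w ^+ 2) \in Lfun P 1.
  exact/Lfun1_integrable/Lfun2_integrable_sqr.
transitivity (\int[P]_(w in event l) (p l ^- 2 * D l w ^+ 2)%:E)%E.
  apply: eq_integral => w; rewrite inE /event /= /randomized => ->.
  by rewrite exprMn exprVn mulrC.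
rewrite integral_event; last 2 first.
- have := Lfun_scale (r := 1) (p l ^- 2) (lexx _) D1.
  by rewrite (_ : _ \o* _ = fun w => p l ^- 2 * D l w ^+ 2)//; apply/funext => w /=; rewrite mulrC.
- apply: (determined_by_comp (h := fun x : R => p l ^- 2 * x ^+ 2) _ (@D_det l)).
  by apply: measurable_funM => //; exact: measurable_funX.
rewrite meanZ//; congr EFin; field.
by rewrite gt_eqF.
Qed.

Lemma expectation_randomized : randomized \in Lfun P 2%:E ->
  ('E_P[randomized] = \sum_(0 <= l <oo) (mean P (D l))%:E)%E.
Proof.
move=> Z2; rewrite unlock -cover_event integral_bigcup//; last first.
  by rewrite cover_event; exact/Lfun1_integrable/Lfun2_Lfun1.
apply: eq_eseriesr => l _.
transitivity (\int[P]_(w in event l) ((p l)^-1 * D l w)%:E)%E.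
  by apply: eq_integral => w; rewrite inE /event /= /randomized mulrC => ->.
rewrite integral_event; last 2 first.
- by apply: Lfun2_Lfun1; exact: Lfun2Z.
- apply: (determined_by_comp (h := fun x : R => (p l)^-1 * x) _ (@D_det l)).
  exact: measurable_funM.
by rewrite meanZ ?Lfun2_Lfun1// mulVKf// gt_eqF.
Qed.

End Randomized.

(** * The correction term kept with probability [q] *)

Section Thinning.
Context {d : measure_display} {Omega : measurableType d} {R : realType}.
Variable P : probability Omega R.

(** Since the 0-1 variable [X] given by [Q] equals its square, the second moment of [q^-1 * X * Z]
    is [q^-1] times that of [Z]. Independence makes its covariance with [L] vanish. *)
Lemma thinned_moments (L Z : Omega -> R) (Q : Omega -> bool) (q : R) :
  0 < q -> measurable_fun setT Q ->
  L \in Lfun P 2%:E -> Z \in Lfun P 2%:E ->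
  independent P Z L -> independent P Q (fun w => (L w, Z w)) ->
  P (Q @^-1` [set true]) = q%:E ->
  let V := fun w => L w + q^-1 * (Q w)%:R * Z w in
  [/\ V \in Lfun P 2%:E, mean P V = mean P L + mean P Z
    & var P V <= var P L + q^-1 * mean P (fun w => Z w ^+ 2)].
Proof.
move=> q0 mQ L2 Z2 ZL QLZ PQ V.
have [L1 Z1] := (Lfun2_Lfun1 L2, Lfun2_Lfun1 Z2).
pose X : Omega -> R := fun w => (Q w)%:R.
have XE : X = \1_(Q @^-1` [set true]).
  apply/funext => w; rewrite indicE /X; case E : (Q w).
    by rewrite mem_set.
  by rewrite memNset//= E.
have mQ1 : measurable (Q @^-1` [set true]).
  by rewrite -[_ @^-1` _]setTI; exact: mQ.
have EX : ('E_P[X] = q%:E)%E by rewrite XE expectation_indic.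
have XX w : X w ^+ 2 = X w.
  by rewrite /X; case: (Q w); rewrite ?expr1n ?expr0n.
have X2 : X \in Lfun P 2%:E.
  apply: Lfun2P; first by rewrite XE; exact: measurable_indic.
  by under eq_fun do rewrite XX; rewrite -/X EX ltry.
have X1 := Lfun2_Lfun1 X2.
have Xind (h : R * R -> R) : measurable_fun setT h ->
    independent P X (fun w => h (L w, Z w)).
  move=> mh; apply: (independent_comp (h := fun b : bool => b%:R : R) _ mh QLZ).
  by move=> _ B mB.
have XM (h : R * R -> R) : measurable_fun setT h ->
    (fun w => h (L w, Z w)) \in Lfun P 1 ->
    (fun w => X w * h (L w, Z w)) \in Lfun P 1 /\
    mean P (fun w => X w * h (L w, Z w)) = q * mean P (fun w => h (L w, Z w)).
  move=> mh h1; have [XY1 XYE] := independent_expectationM X1 h1 (Xind h mh).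
  by split => //; rewrite /mean XYE EX fineM// expectation_fin_num.
have sq1 : (fun w => Z w ^+ 2) \in Lfun P 1.
  exact/Lfun1_integrable/Lfun2_integrable_sqr.
have [XZ21 XZ2E] := XM (fun z => z.2 ^+ 2) (measurable_funX 2 measurable_snd) sq1.
have [XZ1 XZE] := XM snd measurable_snd Z1.
have mW : measurable_fun setT (fun w => X w * Z w).
  by apply: measurable_funM; [exact: Lfun_measurable X2|exact: Lfun_measurable Z2].
have WW w : (X w * Z w) ^+ 2 = X w * Z w ^+ 2 by rewrite exprMn XX.
have W2 : (fun w => X w * Z w) \in Lfun P 2%:E.
  apply: Lfun2P => //; under eq_fun do rewrite WW.
  by rewrite ltey_eq expectation_fin_num.
have VE : V = fun w => L w + q^-1 * (X w * Z w).
  by apply/funext => w; rewrite /V mulrA.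
have qW2 : (fun w => q^-1 * (X w * Z w)) \in Lfun P 2%:E by exact: Lfun2Z.
have W1 : (fun w => X w * Z w) \in Lfun P 1 by exact: Lfun2_Lfun1.
have meanW : mean P (fun w => q^-1 * (X w * Z w)) = mean P Z.
  by rewrite meanZ// XZE mulKf// gt_eqF.
split; first by rewrite VE; exact: Lfun2D.
  by rewrite VE meanD ?Lfun2_Lfun1// meanW.
have varW : var P (fun w => q^-1 * (X w * Z w)) <= q^-1 * mean P (fun w => Z w ^+ 2).
  apply: le_trans (var_le_sqr qW2) _.
  rewrite (_ : (fun w => _ ^+ 2) = fun w => q^-1 ^+ 2 * (X w * Z w ^+ 2)).
    by rewrite meanZ// XZ2E expr2 -mulrA mulKf// gt_eqF.
  by apply/funext => w; rewrite exprMn WW.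
have [LZ1 LZE] := independent_expectationM Z1 L1 ZL.
have mprod : measurable_fun setT (fun z : R * R => z.2 * z.1) by exact: measurable_funM.
have [XLZ1 XLZE] := XM (fun z => z.2 * z.1) mprod LZ1.
have LWE : (L * (fun w => q^-1 * (X w * Z w)))%R =
    fun w => q^-1 * (X w * (Z w * L w)).
  apply/funext => w; transitivity (L w * (q^-1 * (X w * Z w))) => //.
  by rewrite mulrCA; congr (_ * _); rewrite mulrCA [L w * _]mulrC.
have LW1 : (L * (fun w => q^-1 * (X w * Z w)))%R \in Lfun P 1.
  exact: Lfun2_mul_Lfun1.
have cov0 : covariance P L (fun w => q^-1 * (X w * Z w)) = 0%E.
  rewrite covarianceE// ?Lfun2_Lfun1// (meanE LW1) (meanE L1).
  rewrite (meanE (Lfun2_Lfun1 qW2)) meanW LWE meanZ// XLZE mulKf ?gt_eqF//.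
  rewrite [X in (X%:E - _)%E](_ : _ = mean P Z * mean P L).
    by rewrite -EFinM -EFinB mulrC subrr.
  by rewrite [LHS](congr1 fine LZE) fineM// expectation_fin_num.
rewrite VE /var varianceD// cov0 mule0 adde0 fineD ?variance_fin_num//.
by rewrite lerD2l.
Qed.

End Thinning.

(** * Decay of [nu] forced by summability *)

(** By monotonicity each of the first [h + 1] terms is at least the last one, and
    [(h + 1) / sqrt (h + 1) = sqrt (h + 1)]. *)
Lemma sqrt_nu_le {R : realType} (nu : nat -> R) (M : R) :
  (forall i, 0 < nu i) -> nonincreasing_seq nu ->
  (forall n, \sum_(0 <= j < n) Num.sqrt (nu j) / Num.sqrt j.+1%:R <= M) ->
  forall h, Num.sqrt (nu h) * Num.sqrt h.+1%:R <= M.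
Proof.
move=> nu_gt0 nu_decr hM h; apply: le_trans (hM h.+1).
have s0 n : 0 < Num.sqrt n.+1%:R :> R by rewrite sqrtr_gt0 ltr0n.
have -> : Num.sqrt (nu h) * Num.sqrt h.+1%:R =
    \sum_(0 <= j < h.+1) Num.sqrt (nu h) / Num.sqrt h.+1%:R.
  rewrite sumr_const_nat subn0 -[RHS]mulr_natr; have := s0 h.
  have : Num.sqrt h.+1%:R ^+ 2 = h.+1%:R :> R by rewrite sqr_sqrtr.
  move: (Num.sqrt h.+1%:R) => r <- r0.
  by rewrite -mulrA expr2 mulKf// gt_eqF.
rewrite big_nat [leRHS]big_nat; apply: ler_sum => j jh.
apply: ler_pM; rewrite ?invr_ge0 ?sqrtr_ge0//.
  by rewrite ler_wsqrtr// nu_decr// -ltnS.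
by rewrite lef_pV2 ?posrE// ler_wsqrtr// ler_nat.
Qed.

Lemma sqrt_nu_cvg0 {R : realType} (nu : nat -> R) (M : R) :
  (forall i, 0 < nu i) -> nonincreasing_seq nu ->
  (forall n, \sum_(0 <= j < n) Num.sqrt (nu j) / Num.sqrt j.+1%:R <= M) ->
  Num.sqrt (nu h) @[h --> \oo] --> (0 : R).
Proof.
move=> nu_gt0 nu_decr hM; apply/cvgrPdist_le => e e0; near=> h.
rewrite sub0r normrN ger0_norm ?sqrtr_ge0//.
have s0 : 0 < Num.sqrt h.+1%:R :> R by rewrite sqrtr_gt0 ltr0n.
rewrite -(ler_pM2r s0); apply: le_trans (sqrt_nu_le nu_gt0 nu_decr hM h) _.
rewrite mulrC -ler_pdivrMr//; apply: le_trans (ler_norm _) _.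
rewrite -sqrtr_sqr ler_wsqrtr//.
apply: (@le_trans _ _ h%:R); last by rewrite ler_nat.
near: h; exact: nbhs_infty_ger.
Unshelve. all: by end_near. Qed.

(** * Mean, increments and variance of the level averages *)

Section LevelAverages.
Context {d : measure_display} {Omega : measurableType d} {R : realType}.
Variable P : probability Omega R.
Context {d1 : measure_display} {F : measurableType d1}
        {d2 : measure_display} {F' : measurableType d2}.
Variables (g : F * F' -> F) (U : int -> Omega -> F') (x0 : F) (f : F -> R).
Hypothesis mg : measurable_fun [set: F * F'] g.
Hypothesis mU : forall i, measurable_fun [set: Omega] (U i).
Hypothesis iidU : iid P U.
Hypothesis mf : measurable_fun [set: F] f.
Hypothesis f_L2 : forall i : nat, (fun w => f (chain g U x0 i w)) \in Lfun P 2%:E.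
Variable nu : nat -> R.
Hypothesis nu_decr : nonincreasing_seq nu.
Hypothesis nu_bound : forall i m : nat,
  ('E_P[fun w => ((f (shifted_chain g U x0 i%:Z m%:Z w)
                   - f (chain g U x0 i w)) ^+ 2)%R] <= (nu i)%:E)%E.
Variable M : R.
Hypothesis nu_sum : forall n,
  \sum_(0 <= j < n) Num.sqrt (nu j) / Num.sqrt j.+1%:R <= M.

Local Notation fchain := (fchain g U x0 f).
Local Notation block := (block g U x0 f).
Local Notation level := (level_average g U x0 f).

Let fchain2 (s : int) n : fchain s n \in Lfun P 2%:E.
Proof. exact: fchain_Lfun2. Qed.

Lemma level_averageE b' k l : level b' k l =
  fun w => (k - b' k)%:R^-1 * \sum_(b' k <= i < k)
    fchain (- (k * (2 ^ l - 1))%N%:Z) (i + k * (2 ^ l - 1)) w.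
Proof.
by apply/funext => w; rewrite /level_average; congr (_ * _).
Qed.

Lemma level_average_Lfun2 b' k l : level b' k l \in Lfun P 2%:E.
Proof. by rewrite level_averageE; apply: Lfun2Z; exact: Lfun2_sum. Qed.

Lemma level_average_determined b' k l : determined_by U setT (level b' k l).
Proof.
rewrite level_averageE /index_iota; elim: (iota _ _) => [|i s IH].
  rewrite (_ : (fun _ => _) = cst 0); first exact: measurable_cst.
  by apply/funext => w; rewrite big_nil mulr0.
under eq_fun do rewrite big_cons mulrDr.
have Fdet : determined_by U setT (fun w => (k - b' k)%:R^-1 *
    fchain (- (k * (2 ^ l - 1))%N%:Z) (i + k * (2 ^ l - 1)) w).
  apply: (determined_by_comp (h := fun x : R => (k - b' k)%:R^-1 * x)).
    exact: measurable_funM.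
  apply: sub_determined_by (@fchain_determined _ _ _ _ _ _ _ g U x0 f mg mf _ _).
  exact: subsetT.
exact: (@measurable_funD _ (g_sigma_algebraType (preimages_on U setT)) R setT
  _ _ Fdet IH).
Qed.

Lemma level_average_mean (mu : R) b' k l : (b' k < k)%N ->
  (forall h, `|mean P (fchain 0 h) - mu| <= Num.sqrt (nu h)) ->
  `|mean P (level b' k l) - mu| <= Num.sqrt (nu (k * (2 ^ l - 1))%N).
Proof.
move=> bk hmu; have n0 : 0 < (k - b' k)%:R :> R by rewrite ltr0n subn_gt0.
set K := (k * _)%N.
have -> : mean P (level b' k l) - mu = (k - b' k)%:R^-1 *
    \sum_(b' k <= i < k) (mean P (fchain 0 (i + K)) - mu).
  rewrite level_averageE meanZ; last by apply: Lfun2_Lfun1; exact: Lfun2_sum.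
  rewrite mean_sum// big_split/= sumr_const_nat mulrDr; congr (_ + _).
    by congr (_ * _); apply: eq_bigr => i _; exact: fchain_mean.
  by rewrite mulNrn mulrN -[mu *+ _]mulr_natl mulKf// gt_eqF.
rewrite normrM gtr0_norm ?invr_gt0// ler_pdivrMl//.
rewrite mulr_natl -sumr_const_nat; apply: le_trans (ler_norm_sum _ _ _) _.
apply: ler_sum => i _; apply: le_trans (hmu _) _.
by rewrite ler_wsqrtr// nu_decr// leq_addl.
Qed.

(** The chain of level [l + 1] starts [k * 2^l] time units before that of level [l]. The squared
    average of the differences is at most the average of their squares, and each of these is a
    coupling error. *)
Lemma level_increment_le b' k l : (b' k < k)%N ->
  mean P (fun w => (level b' k l.+1 w - level b' k l w) ^+ 2) <=
  (k - b' k)%:R^-1 * \sum_(b' k <= i < k) nu (i + k * (2 ^ l - 1)).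
Proof.
move=> bk; have n0 : 0 < (k - b' k)%:R :> R by rewrite ltr0n subn_gt0.
rewrite !level_averageE; set K := (k * (2 ^ l - 1))%N.
pose m := (k * 2 ^ l)%N.
have -> : (k * (2 ^ l.+1 - 1) = K + m)%N.
  rewrite /K /m expnS; have : (0 < 2 ^ l)%N by rewrite expn_gt0.
  by move: (2 ^ l)%N; clear; nia.
pose D i w := fchain (- K%:Z - m%:Z) (i + K + m) w - fchain (- K%:Z) (i + K) w.
have D2 i : D i \in Lfun P 2%:E by exact: Lfun2B.
have sq1 (X : Omega -> R) : X \in Lfun P 2%:E -> (fun w => X w ^+ 2) \in Lfun P 1.
  by move=> X2; exact/Lfun1_integrable/Lfun2_integrable_sqr.
have le w : ((k - b' k)%:R^-1 * \sum_(b' k <= i < k) D i w) ^+ 2 <=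
    (k - b' k)%:R^-1 * \sum_(b' k <= i < k) D i w ^+ 2.
  rewrite exprMn expr2 -mulrA ler_wpM2l ?invr_ge0 ?(ltW n0)// ler_pdivrMl//.
  exact: sqr_sum_le.
rewrite (_ : (fun w => _) = fun w =>
    ((k - b' k)%:R^-1 * \sum_(b' k <= i < k) D i w) ^+ 2); last first.
  apply/funext => w; congr (_ ^+ 2); rewrite -mulrBr -sumrB; congr (_ * _).
  by apply: eq_bigr => i _; rewrite /D addnA -opprD PoszD.
apply: (@le_trans _ _ (mean P (fun w =>
    (k - b' k)%:R^-1 * \sum_(b' k <= i < k) D i w ^+ 2))).
  have iD : (fun w => (k - b' k)%:R^-1 * \sum_(b' k <= i < k) D i w ^+ 2)
      \in Lfun P 1.
    rewrite /index_iota; elim: (iota _ _) => [|i s IH].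
      rewrite (_ : (fun _ => _) = cst 0) ?Lfun_cst//.
      by apply/funext => w; rewrite big_nil mulr0.
    under eq_fun do rewrite big_cons mulrDr.
    have [_ LD] := Lfun_addr_closed P (lexx 1%E).
    apply: (LD (fun w => (k - b' k)%:R^-1 * D i w ^+ 2)) => //.
    have := Lfun_scale (r := 1) (k - b' k)%:R^-1 (lexx _) (sq1 _ (D2 i)).
    rewrite (_ : _ \o* _ = fun w => (k - b' k)%:R^-1 * D i w ^+ 2)//.
    by apply/funext => w /=; rewrite mulrC.
  have iS := sq1 _ (Lfun2Z (k - b' k)%:R^-1 (Lfun2_sum (b' k) k D2)).
  rewrite -lee_fin -!meanE//; apply: expectation_le.
  - exact: Lfun_measurable iS.
  - exact: Lfun_measurable iD.
  - by move=> w; exact: sqr_ge0.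
  - by move=> w; apply: le_trans (le w); exact: sqr_ge0.
  - exact: aeW.
have E n : (fun w => \sum_(b' k <= i < n) D i w ^+ 2) \in Lfun P 1 /\
    mean P (fun w => \sum_(b' k <= i < n) D i w ^+ 2) =
    \sum_(b' k <= i < n) mean P (fun w => D i w ^+ 2).
  elim: n => [|n [IH1 IH2]].
    rewrite (_ : (fun _ => _) = cst 0); last by apply/funext => w; rewrite big_geq.
    by rewrite big_geq// /mean expectation_cst Lfun_cst.
  have [bn|nb] := leqP (b' k) n; last first.
    rewrite (_ : (fun _ => _) = cst 0); last by apply/funext => w; rewrite big_geq.
    by rewrite big_geq// /mean expectation_cst Lfun_cst.
  rewrite big_nat_recr//=; under eq_fun do rewrite big_nat_recr//=.
  have [_ LD] := Lfun_addr_closed P (lexx 1%E).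
  split; first exact: (LD _ _ IH1 (sq1 _ (D2 n))).
  by rewrite meanD ?IH2//; exact: sq1.
have [E1 E2] := E k.
rewrite meanZ// E2 ler_wpM2l ?invr_ge0 ?(ltW n0)//; apply: ler_sum => i _.
exact: fchain_coupling.
Qed.

Lemma level_average0 b' k : level b' k 0 =
  fun w => (k - b' k)%:R^-1 * block 0 (b' k) (k - b' k) w.
Proof.
rewrite level_averageE expn0 subnn muln0 oppr0; apply/funext => w.
congr (_ * _); rewrite /block -{1}[b' k]add0n big_addn.
by apply: eq_bigr => i _; rewrite addn0 addnC.
Qed.

Lemma time_averageE b k : time_average g U x0 f b k =
  fun w => (k - b k)%:R^-1 * block 0 (b k) (k - b k) w.
Proof.
apply/funext => w; rewrite /time_average; congr (_ * _).
rewrite /block -{1}[b k]add0n big_addn.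
by apply: eq_bigr => i _; rewrite addnC /fchain -chainE.
Qed.

Lemma level_average_var b b' k : (0 < k)%N -> (b k <= b' k)%N ->
  (2 * b' k <= k)%N ->
  k%:R * var P (level b' k 0) <= k%:R * var P (time_average g U x0 f b k) +
    796 * M ^+ 2 * Num.sqrt ((b' k - b k)%:R / k%:R).
Proof.
move=> k0 bb' b'k; rewrite level_average0 time_averageE.
set del := (b' k - b k)%N; set n := (k - b k)%N; set n' := (k - b' k)%N.
have nE : n = (n' + del)%N by rewrite /n /n' /del; lia.
have [n0 n'0] : (0 < n)%N /\ (0 < n')%N by rewrite /n /n'; lia.
have M0 : 0 <= M by apply: le_trans (nu_sum 0); rewrite big_geq.
pose sg := 11 / 2 * M.
have sg0 : 0 <= sg by rewrite mulr_ge0// divr_ge0.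
have sdB m j : sd P (block 0 m j) <= sg * Num.sqrt j%:R.
  exact: (sd_block mg mU iidU mf f_L2 nu_bound nu_sum).
have B2 m j : block 0 m j \in Lfun P 2%:E by exact: block_Lfun2.
pose A w := n%:R^-1 * block 0 (b k) n w.
(* [A] averages over the longer range from [b k], and [W] corrects it: the retained block is
   reweighted, the first [del] terms are removed. *)
pose W w := (n'%:R^-1 - n%:R^-1) * block 0 (b' k) n' w +
            - n%:R^-1 * block 0 (b k) del w.
have A2 : A \in Lfun P 2%:E by exact: Lfun2Z.
have W2 : W \in Lfun P 2%:E by apply: Lfun2D; exact: Lfun2Z.
have -> : (fun w => n'%:R^-1 * block 0 (b' k) n' w) = fun w => A w + W w.
  apply/funext => w; rewrite /A /W.
  have -> : block 0 (b k) n w = block 0 (b k) del w + block 0 (b' k) n' w.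
    rewrite /block nE addnC (big_cat_nat (n := del))//=; last by lia.
    congr (_ + _); rewrite -{1}[del]add0n big_addn addKn.
    by apply: eq_bigr => i _; congr (fchain _ _ _); rewrite /del; lia.
  by ring.
have [nR n'R] : 0 < n%:R :> R /\ 0 < n'%:R :> R by rewrite !ltr0n.
have vA : sd P A <= sg / Num.sqrt n%:R.
  rewrite /A sdZ// gtr0_norm ?invr_gt0// ler_pdivrMl//.
  rewrite (_ : n%:R * (sg / Num.sqrt n%:R) = sg * Num.sqrt n%:R)//.
  have r0 : 0 < Num.sqrt n%:R :> R by rewrite sqrtr_gt0.
  rewrite -{1}[n%:R](@sqr_sqrtr R) ?ler0n//.
  by move: (Num.sqrt n%:R) r0 => r r0; field; rewrite gt_eqF.
have dn' : (del <= n')%N by rewrite /del /n'; lia.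
(* Each of the two pieces contributes at most half of the bound; for the reweighted block this uses
   [del <= n']. *)
have wW : sd P W <= 2 * sg * Num.sqrt del%:R / n%:R.
  apply: le_trans (sdD (Lfun2Z _ (B2 _ _)) (Lfun2Z _ (B2 _ _))) _.
  rewrite !sdZ// normrN [in X in _ + X]gtr0_norm ?invr_gt0//.
  have -> : n'%:R^-1 - n%:R^-1 = del%:R / (n'%:R * n%:R) :> R.
    by rewrite nE natrD; field; rewrite -natrD -nE !gt_eqF.
  rewrite ger0_norm ?divr_ge0 ?mulr_ge0//.
  have -> : 2 * sg * Num.sqrt del%:R / n%:R =
      n%:R^-1 * (sg * Num.sqrt del%:R) + n%:R^-1 * (sg * Num.sqrt del%:R) by ring.
  apply: lerD; last by rewrite ler_wpM2l ?invr_ge0.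
  apply: (@le_trans _ _ (del%:R / (n'%:R * n%:R) * (sg * Num.sqrt n'%:R))).
    by rewrite ler_wpM2l// divr_ge0// mulr_ge0.
  set x := Num.sqrt n'%:R; set y := Num.sqrt del%:R.
  have x0' : 0 < x by rewrite sqrtr_gt0.
  have y0 : 0 <= y by exact: sqrtr_ge0.
  have yx : y <= x by rewrite ler_wsqrtr// ler_nat.
  have -> : n'%:R = x ^+ 2 by rewrite sqr_sqrtr.
  have -> : del%:R = y ^+ 2 by rewrite sqr_sqrtr.
  have -> : y ^+ 2 / (x ^+ 2 * n%:R) * (sg * x) = n%:R^-1 * (sg * y) * (y / x).
    by field; rewrite !gt_eqF.
  rewrite ler_piMr//; first by rewrite !mulr_ge0 ?invr_ge0.
  by rewrite ler_pdivrMr// mul1r.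
have [kn' delk nk] : [/\ (k <= 2 * n')%N, (2 * del <= k)%N & (n <= k)%N].
  by split; rewrite /n' /del /n; lia.
have gap := averaging_gap k0 nE kn' delk nk sg0 (sd_ge0 P A) (sd_ge0 P W) vA wW.
have vAW : var P (fun w => A w + W w) <= (sd P A + sd P W) ^+ 2.
  rewrite -sd_sqr ler_sqr ?nnegrE ?addr_ge0 ?sd_ge0//; exact: sdD.
(* Numerically, [23 * (11/2)^2 = 695.75]. *)
have c796 : 23 * sg ^+ 2 <= 796 * M ^+ 2.
  by rewrite /sg exprMn; have := sqr_ge0 M; lra.
have {}gap := le_trans gap (ler_wpM2r (sqrtr_ge0 (del%:R / k%:R)) c796).
apply: le_trans (ler_wpM2l (ler0n R k) vAW) _.
by move: gap; rewrite sd_sqr mulrBr lerBlDl.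
Qed.

End LevelAverages.

(** * Convergence from a vanishing gap, and expected cost *)

Lemma cvg_of_gap {R : realType} (a c : nat -> R) (mu : R) :
  (forall n, `|a n - mu| <= c n) -> c n @[n --> \oo] --> (0 : R) ->
  a n @[n --> \oo] --> mu.
Proof.
move=> ac c0; apply/cvgrPdist_le => e e0.
have /cvgrPdist_le/(_ _ e0) := c0; apply: filterS => n.
rewrite sub0r normrN => cn; rewrite distrC.
by apply: le_trans (ac n) _; apply: le_trans cn; exact: ler_norm.
Qed.

(** With [p_l <= 1 / (theta l * 2^l)] and [tau k l <= 3 * k * 2^l], the powers of 2 cancel and level
    [l] costs at most [3 * k / theta l] on average. *)
Lemma unbiased_time_le {R : realType} (theta : R -> R) (tau : nat -> nat -> R)
    (q : R) (k : nat) :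
  (forall x y : R, 0 <= x -> x <= y -> theta x <= theta y) ->
  (forall x : R, 0 <= x <= 1 -> theta x = 1) ->
  (sum_inv_theta theta < +oo)%E -> 0 < q ->
  (forall k l : nat, 0 <= tau k l <= level_time k l.+1 + level_time k l) ->
  (unbiased_time (level_prob theta) tau q k <=
     k%:R%:E + 3%:E * sum_inv_theta theta * q%:E * k%:R%:E)%E.
Proof.
move=> theta_incr theta1 theta_sum q0 htau.
have t0 l : 0 < theta l%:R by exact: theta_nat_gt0.
have inv0 l : (0 <= (1 / theta l%:R)%:E)%E.
  by rewrite lee_fin divr_ge0// ltW.
have fin : sum_inv_theta theta \is a fin_num.
  by rewrite ge0_fin_numE//; exact: nneseries_ge0.
have Zle : (Z_time (level_prob theta) tau k <= (3 * k%:R)%:E * sum_inv_theta theta)%E.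
  rewrite /Z_time /sum_inv_theta -nneseriesZl; last by move=> l _; exact: inv0.
  have p0 l := level_prob_gt0 theta_incr theta1 l.
  apply: lee_nneseries => [l _ _|l _]; have /andP[tau0 tau1] := htau k l.
    by rewrite lee_fin mulr_ge0// ltW.
  rewrite -EFinM lee_fin.
  apply: le_trans (ler_pM (ltW (p0 l)) tau0 (level_prob_le theta_incr theta1 l) tau1) _.
  rewrite /level_time !natrM !natrX exprS le_eqVlt; apply/orP; left; apply/eqP.
  by field; rewrite !gt_eqF// exprn_gt0.
rewrite /unbiased_time leeD2l//.
apply: le_trans (lee_wpmul2l _ Zle) _; first by rewrite lee_fin ltW.
by rewrite -(fineK fin) -!EFinM lee_fin le_eqVlt; apply/orP; left; apply/eqP; ring.
Qed.

(** * Second moment and mean of the correction term *)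

Section CorrectionTerm.
Context {d : measure_display} {Omega : measurableType d} {R : realType}.
Variable P : probability Omega R.
Context {d1 : measure_display} {F : measurableType d1}
        {d2 : measure_display} {F' : measurableType d2}.
Variables (g : F * F' -> F) (U : int -> Omega -> F') (x0 : F) (f : F -> R).
Hypothesis mg : measurable_fun [set: F * F'] g.
Hypothesis mU : forall i, measurable_fun [set: Omega] (U i).
Hypothesis iidU : iid P U.
Hypothesis mf : measurable_fun [set: F] f.
Hypothesis f_L2 : forall i : nat, (fun w => f (chain g U x0 i w)) \in Lfun P 2%:E.
Variables (nu : nat -> R) (theta : R -> R).
Hypothesis nu_gt0 : forall i, 0 < nu i.
Hypothesis nu_decr : nonincreasing_seq nu.
Hypothesis nu_cvg0 : Num.sqrt (nu h) @[h --> \oo] --> (0 : R).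
Hypothesis nu_bound : forall i m : nat,
  ('E_P[fun w => ((f (shifted_chain g U x0 i%:Z m%:Z w)
                   - f (chain g U x0 i w)) ^+ 2)%R] <= (nu i)%:E)%E.
Hypothesis theta_incr : forall x y : R, 0 <= x -> x <= y -> theta x <= theta y.
Hypothesis theta1 : forall x : R, 0 <= x <= 1 -> theta x = 1.
Hypothesis nu_theta_sum : (nu_bar_theta nu theta 0 < +oo)%E.
Variable N : {RV P >-> nat}.
Hypothesis N_law : forall l : nat,
  P (N @^-1` [set l]) = (level_prob theta l)%:E.
Hypothesis N_indep : independent_of_family P N U.
Variables (b' : nat -> nat) (k : nat).
Hypotheses (k0 : (0 < k)%N) (hb' : (2 * b' k <= k)%N).

Local Notation level := (level_average g U x0 f b' k).
Local Notation Z := (Z_estimator g U x0 f b' (level_prob theta) N k).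

Let D l w := level l.+1 w - level l w.

Let level2 l : level l \in Lfun P 2%:E.
Proof. exact: level_average_Lfun2. Qed.

Let D2 l : D l \in Lfun P 2%:E. Proof. exact: Lfun2B. Qed.

Let D_det l : determined_by U setT (D l).
Proof.
apply: (determined_by_comp (X := fun w => (level l.+1 w, level l w))
  (h := fun z : R * R => z.1 - z.2)); first exact: measurable_funB.
by apply: determined_by_pair; exact: level_average_determined.
Qed.

Lemma Z_estimator_measurable : measurable_fun setT Z.
Proof. exact: (randomized_measurable N (level_prob theta) D2). Qed.

Lemma Z_estimator_sqr_le :
  ('E_P[fun w => (Z w ^+ 2)%R] <=
   (16 * fine (nu_bar_theta nu theta (b' k)./2) ^+ 2 / k%:R)%:E)%E.
Proof.
have p0 := level_prob_gt0 theta_incr theta1.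
have e0 l : 0 <= mean P (fun w => D l w ^+ 2).
  by rewrite fine_ge0// expectation_ge0// => w; exact: sqr_ge0.
have := expectation_randomized_sqr p0 N_law N_indep D2 D_det.
rewrite /randomized => ->; apply: lime_le.
  by apply: is_cvg_nneseries => l _ _; rewrite lee_fin divr_ge0// ltW.
apply: nearW => n; rewrite sumEFin lee_fin ler_pdivlMr ?ltr0n// mulrC.
apply: level_sum_le => // l; apply: level_increment_le => //; lia.
Qed.

Lemma Z_estimator_Lfun2 : Z \in Lfun P 2%:E.
Proof.
apply: Lfun2P; first exact: Z_estimator_measurable.
by apply: le_lt_trans Z_estimator_sqr_le _; exact: ltry.
Qed.

(** The expected increments telescope to the limit of the level means minus the mean at level 0. *)
Lemma Z_estimator_mean (mu : R) :
  (forall h, `|mean P (fchain g U x0 f 0 h) - mu| <= Num.sqrt (nu h)) ->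
  mean P Z = mu - mean P (level 0).
Proof.
move=> hmu; have p0 := level_prob_gt0 theta_incr theta1.
have level_cvg : mean P (level n) @[n --> \oo] --> mu.
  apply: cvg_of_gap nu_cvg0 => n.
  apply: le_trans (level_average_mean mg mU iidU mf f_L2 nu_decr n _ hmu) _.
    by lia.
  (* Level [n] chains have run for at least [k * (2^n - 1) >= n] steps, so their bias is at most
     [sqrt (nu n)]. *)
  rewrite ler_wsqrtr// nu_decr//; have : (n < 2 ^ n)%N by exact: ltn_expl.
  by move: (2 ^ n)%N k0; clear; nia.
have := expectation_randomized p0 N_law N_indep D2 D_det Z_estimator_Lfun2.
rewrite {2}/mean => ZE; rewrite /mean [X in fine X]ZE.
rewrite (_ : (fun n => _) = fun n => (mean P (level n) - mean P (level 0))%:E); last first.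
  apply/funext => n; rewrite sumEFin -(telescope_sumr (fun l => mean P (level l)))//.
  congr EFin; apply: eq_bigr => l _.
  by rewrite -meanB//; exact: Lfun2_Lfun1.
rewrite (cvg_lim _ (l := (mu - mean P (level 0))%:E))//.
by apply: cvg_EFin; [exact: nearW|apply: cvgB => //; exact: cvg_cst].
Qed.

End CorrectionTerm.

(** * Unbiasedness, variance and cost combined *)

Theorem theorem3p3 (R : realType)
  (d : measure_display) (Omega : measurableType d) (P : probability Omega R)
  (d1 : measure_display) (F : measurableType d1)
  (d2 : measure_display) (F' : measurableType d2)
  (g : F * F' -> F) (mg : measurable_fun [set: F * F'] g)
  (U : int -> Omega -> F') (mU : forall i, measurable_fun [set: Omega] (U i))
  (iidU : iid P U)
  (x0 : F)
  (f : F -> R) (mf : measurable_fun [set: F] f)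
  (f_L2 : forall i : nat, (fun w => f (chain g U x0 i w)) \in Lfun P 2%:E)
  (b b' : nat -> nat)
  (hb : forall k : nat, (1 <= k)%N -> (b k <= b' k)%N /\ (2 * b' k <= k)%N)
  (nu : nat -> R) (nu_gt0 : forall i, 0 < nu i) (nu_decr : nonincreasing_seq nu)
  (nu_sum : (nu_bar nu 0 < +oo)%E)
  (nu_bound : forall i m : nat,
    ('E_P[fun w => ((f (shifted_chain g U x0 i%:Z m%:Z w)
                     - f (chain g U x0 i w)) ^+ 2)%R] <= (nu i)%:E)%E)
  (theta : R -> R)
  (theta_incr : forall x y : R, 0 <= x -> x <= y -> theta x <= theta y)
  (theta1 : forall x : R, 0 <= x <= 1 -> theta x = 1)
  (theta_sum : (sum_inv_theta theta < +oo)%E)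
  (nu_theta_sum : (nu_bar_theta nu theta 0 < +oo)%E)
  (N : {RV P >-> nat})
  (N_law : forall l : nat, P (N @^-1` [set l]) = (level_prob theta l)%:E)
  (N_indep : independent_of_family P N U)
  (q : R) (hq : 0 < q <= 1)
  (tau : nat -> nat -> R)
  (htau : forall k l : nat,
    0 <= tau k l <= level_time k l.+1 + level_time k l) :
  exists mu : R,
    ('E_P[fun w => f (chain g U x0 h w)]%E @[h --> \oo] --> mu%:E) /\
    forall k : nat, (1 <= k)%N ->
      (forall (Z' : {RV P >-> R}) (Q : {RV P >-> bool}),
        same_law P Z' (Z_estimator g U x0 f b' (level_prob theta) N k) ->
        independent P Z' (level_average g U x0 f b' k 0) ->
        independent P Q (fun w => (level_average g U x0 f b' k 0 w, Z' w)) ->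
        P (Q @^-1` [set true]) = q%:E ->
        let fhat := unbiased_estimator g U x0 f b' q Z' Q k in
        [/\ fhat \in Lfun P 2%:E,
            'E_P[fhat]%E = mu%:E
          & (k%:R%:E * 'V_P[fhat] <=
               k%:R%:E * 'V_P[time_average g U x0 f b k]
               + 796%:E * nu_bar nu 0 ^+ 2
                   * (Num.sqrt ((b' k - b k)%:R / k%:R))%:E
               + (28 / q)%:E * nu_bar_theta nu theta (b' k)./2 ^+ 2)%E]) /\
      (unbiased_time (level_prob theta) tau q k <=
         k%:R%:E + 3%:E * sum_inv_theta theta * q%:E * k%:R%:E)%E.
Proof.
have [q0 _] := andP hq.
pose S j := fine (nu_bar_theta nu theta j).
pose M := fine (nu_bar nu 0).
have uM n : \sum_(0 <= j < n) Num.sqrt (nu j) / Num.sqrt j.+1%:R <= M.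
  have := nneseries_partial 0 n (fun i => sqrtr_ge0 (nu i / i.+1%:R)) nu_sum.
  apply: le_trans; apply: ler_sum => i _.
  by rewrite sqrtrM ?(ltW (nu_gt0 _))// sqrtrV ?ler0n.
have nu0 := sqrt_nu_cvg0 nu_gt0 nu_decr uM.
have ME : nu_bar nu 0 = M%:E.
  by rewrite fineK// ge0_fin_numE//; apply: nneseries_ge0 => i _ _; rewrite lee_fin sqrtr_ge0.
have SE j : nu_bar_theta nu theta j = (S j)%:E.
  have u0 i : (0 <= (Num.sqrt (nu i * theta (log2 (4 * i + 1)%:R) / i.+1%:R))%:E)%E.
    by rewrite lee_fin sqrtr_ge0.
  rewrite fineK// ge0_fin_numE; last by apply: nneseries_ge0 => i _ _.
  apply: le_lt_trans nu_theta_sum.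
  rewrite /nu_bar_theta (@nneseries_split _ _ 0 j)// leeDr//.
  by apply: sume_ge0.
have [mu hmu] := mean_fchain_limit mg mU iidU mf f_L2 nu_bound.
exists mu; split.
  rewrite (_ : (fun h => _) = fun h => (mean P (fchain g U x0 f 0 h))%:E).
    by apply: cvg_EFin; [exact: nearW|exact: cvg_of_gap hmu nu0].
  apply/funext => h; have := f_L2 h; rewrite chainE => fL2.
  exact: meanE (Lfun2_Lfun1 fL2).
move=> k k0; split; last exact: unbiased_time_le.
move=> Z' Q Zlaw ZL QLZ PQ fhat.
have [bb' hb'] := hb k k0.
set L := level_average g U x0 f b' k 0 in ZL QLZ.
set Z := Z_estimator g U x0 f b' (level_prob theta) N k in Zlaw.
have L2 : L \in Lfun P 2%:E by exact: level_average_Lfun2.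
have Z2 : Z \in Lfun P 2%:E by exact: (Z_estimator_Lfun2 mg mU iidU).
have mZ : measurable_fun setT Z by exact: Lfun_measurable Z2.
have mZ' : measurable_fun setT Z' by exact: measurable_funP.
(* The mean and second moment of [Z'] are computed on [Z], which has the same law. *)
have ZZ' (h : R -> R) : measurable_fun setT h ->
    mean P (fun w => h (Z' w)) = mean P (fun w => h (Z w)).
  by move=> mh; congr fine; exact: (same_law_expectation mZ' mZ mh Zlaw).
have Z'2 : (Z' : Omega -> R) \in Lfun P 2%:E.
  by apply: same_law_Lfun2 Z2 => // A mA; rewrite (Zlaw A mA).
have mQ : measurable_fun setT Q by exact: measurable_funP.
have [V2 Vmean Vvar] := thinned_moments q0 mQ L2 Z'2 ZL QLZ PQ.
have Zmean : mean P Z' = mu - mean P L.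
  rewrite (ZZ' id)//.
  exact: (Z_estimator_mean mg mU iidU mf f_L2 nu_gt0 nu_decr nu0 nu_bound
    theta_incr theta1 nu_theta_sum N_law N_indep k0 hb' hmu).
have Zsqr : mean P (fun w => Z' w ^+ 2) <= 16 * S (b' k)./2 ^+ 2 / k%:R.
  rewrite (ZZ' (fun x => x ^+ 2)); last exact: measurable_funX.
  rewrite -lee_fin /mean (fineK (Lfun2_expectation Z2)).
  exact: (Z_estimator_sqr_le mg mU iidU mf f_L2 nu_gt0 nu_decr nu_bound
    theta_incr theta1 nu_theta_sum N_law N_indep k0 hb').
split.
- exact: V2.
- rewrite (meanE (Lfun2_Lfun1 V2)); congr EFin.
  by rewrite Vmean Zmean addrC subrK.
have T2 : time_average g U x0 f b k \in Lfun P 2%:E.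
  by rewrite time_averageE; apply: Lfun2Z; exact: block_Lfun2.
rewrite (varE V2) (varE T2) ME SE -!EFin_expe -!EFinM -!EFinD lee_fin.
have kR : 0 < k%:R :> R by rewrite ltr0n.
apply: le_trans (ler_wpM2l (ltW kR) Vvar) _; rewrite mulrDr; apply: lerD.
  exact: (level_average_var mg mU iidU mf f_L2 nu_bound uM).
apply: le_trans (ler_wpM2l (ltW kR) (ler_wpM2l _ Zsqr)) _.
  by rewrite invr_ge0 ltW.
(* The factor [k] cancels, and the resulting [16 / q] is below [28 / q]. *)
rewrite [leLHS](_ : _ = 16 / q * S (b' k)./2 ^+ 2).
  by rewrite ler_wpM2r ?sqr_ge0// ler_wpM2r ?invr_ge0 ?(ltW q0)// ler_nat.
by field; rewrite !gt_eqF.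
Qed.
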